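(* Let $K$ and $L$ be origin-symmetric convex bodies in $\mathbb{R}^2$ with $C^2$ boundaries of everywhere positive curvature. Then $$\int_{\mathbb{S}^1}\log\left(\frac{\kappa_K}{\kappa_L}\right)dV_L+\frac{V(L)}{2}\log\left(\frac{V(K)}{V(L)}\right)\geq 0,$$ with equality if and only if $K$ and $L$ are dilates, i.e. $K=cL$ for some $c>0$.
   Context: A convex body in $\mathbb{R}^2$ is a compact convex set with non-empty interior; it is origin-symmetric if $K=-K$. The support function is $h_K(u)=\max\{x\cdot u: x\in K\}$, $u\in\mathbb{S}^1$. $V(K)$ is the area of $K$. For a convex body $K$ with $C^2$ boundary of positive curvature, $\kappa_K$ denotes the curvature of $\partial K$, regarded via the Gauss map as a function on $\mathbb{S}^1$: $\kappa_K(u)$ is the curvature of $\partial K$ at the unique boundary point with outer unit normal $u$. One has $1/\kappa_K=h_K+h_K''$, where derivatives are with respect to the angle on $\mathbb{S}^1$. The measure $dS_K$ is arc length on $\partial K$, which transported to $\mathbb{S}^1$ by the Gauss map is $dS_K=\frac{1}{\kappa_K}\,du$, where $du$ is arc length on $\mathbb{S}^1$. The cone-volume measure of $L$ is the Borel measure on $\mathbb{S}^1$ given by $dV_L=\frac12 h_L\,dS_L=\frac{h_L}{2\kappa_L}\,du$. *)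

(* Defs.v *)
From HB Require Import structures.
From mathcomp Require Import all_boot all_order all_algebra.
From mathcomp Require Import all_classical all_reals all_analysis.

Set Implicit Arguments.
Unset Strict Implicit.
Unset Printing Implicit Defensive.

Import Order.TTheory GRing.Theory Num.Theory.
Import numFieldNormedType.Exports.

Local Open Scope ring_scope.
Local Open Scope classical_set_scope.

Section plane.
Variable R : realType.
Implicit Types (p u : R * R) (K L A B : set (R * R)).

Definition dot p u : R := p.1 * u.1 + p.2 * u.2.

Definition circle : set (R * R) := [set u | dot u u = 1].

Definition convex_body K : Prop :=
  [/\ compact K, convex_set K & K° !=set0].

Definition origin_symmetric K : Prop := K = [set - p | p in K].

Definition boundary K : set (R * R) := closure K `\` K°.

Definition support_function K u : R := sup [set dot p u | p in K].

(* The product measure is extended-real valued; it is finite on convex bodies. *)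
Definition area K : R := fine ((lebesgue_measure \x lebesgue_measure)%E K).

Definition C2 (f : R -> R) : Prop :=
  [/\ forall t, derivable f t 1, forall t, derivable (derive1 f) t 1
    & continuous (derive1n 2 f)].

(* [t |-> (x t, y t)] is a regular C^2 parametrization, with period [T], of
   the simple closed curve [B]. *)
Definition C2_closed_curve B (x y : R -> R) (T : R) : Prop :=
  [/\ C2 x /\ C2 y,
      forall t, (derive1 x t, derive1 y t) != 0,
      0 < T /\ (forall t, x (t + T) = x t /\ y (t + T) = y t),
      {in `[0, T[ &, injective (fun t => (x t, y t))}
    & range (fun t => (x t, y t)) = B].

(* Unsigned, hence independent of the orientation of the parametrization; on
   the boundary of a convex body it is the curvature with respect to the inner
   normal. *)
Definition curve_curvature (x y : R -> R) (t : R) : R :=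
  `|derive1 x t * derive1n 2 y t - derive1 y t * derive1n 2 x t|
    / Num.sqrt (derive1 x t ^+ 2 + derive1 y t ^+ 2) ^+ 3.

Definition has_C2_boundary K : Prop :=
  exists x y T, C2_closed_curve (boundary K) x y T.

(* The curvature does not depend on the parametrization, so [get] selects from
   a singleton when [K] has a C^2 boundary and [p] is a boundary point. *)
Definition boundary_curvature K p : R :=
  get [set k | exists x y T t, [/\ C2_closed_curve (boundary K) x y T,
                                   (x t, y t) = p & k = curve_curvature x y t]].

Definition has_C2_boundary_of_positive_curvature K : Prop :=
  has_C2_boundary K /\ forall p, boundary K p -> 0 < boundary_curvature K p.

Definition is_outer_unit_normal K p u : Prop :=
  circle u /\ forall q, K q -> dot q u <= dot p u.

(* The [get] selects the unique such boundary point when [K] is a convex body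
   with C^2 boundary of positive curvature and [u] is on the circle. *)
Definition inverse_gauss_map K u : R * R :=
  get [set p | boundary K p /\ is_outer_unit_normal K p u].

Definition curvature K u : R := boundary_curvature K (inverse_gauss_map K u).

(* Arc length on the circle: image of the Lebesgue measure on [0, 2 pi[ under
   the angular parametrization. *)
Definition circle_measure : set (R * R) -> \bar R :=
  pushforward (mrestr lebesgue_measure (measurable_itv `[0, 2 * pi[%R))
    (fun t : R => (cos t, sin t)).

(* Given by its density with respect to arc length; as a measure on the plane,
   it is carried by the circle. *)
Definition cone_volume_measure L : set (R * R) -> \bar R := fun A =>
  (\int[circle_measure]_(u in A `&` circle)
     (support_function L u / (2 * curvature L u))%:E)%E.

Definition dilates K L : Prop :=
  exists2 c : R, 0 < c & K = [set c *: p | p in L].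

End plane.

Arguments circle {R}.
Arguments circle_measure {R}.

(* Main.v *)
Require Import Defs.
From HB Require Import structures.
From mathcomp Require Import all_boot all_order all_algebra.
From mathcomp Require Import all_classical all_reals all_analysis.
From mathcomp Require Import measurable_realfun.
From mathcomp Require Import ring lra.

(** Write [h] for the support function of a body as a function of the angle of
the normal, and [r = h + h''] for its radius of curvature, the inverse of the
curvature. In the angle, the cone-volume measure of [L] is [hL * rL / 2], the
area is the integral of [h * r / 2] over a period, and the claim becomes an
inequality between integrals [I] over a period,
[I (ln (rL / rK) * hL * rL / 2) + AL / 2 * ln (AK / AL) >= 0].

The analytic core is the following. Let [t = hK / hL] at some angle. The function
[f = hK - t * hL] has period [pi] by symmetry and vanishes at this angle, so
Wirtinger's inequality [wirtinger] gives [I (f ^+ 2) <= I (f' ^+ 2)]. Integrating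
by parts, this reads [AK - 2 * t * B + t ^+ 2 * AL <= 0], where [B] is the mixed
area; this is [bonnesen]. Put [a = AK / AL], [b = B / AL] and
[s = sqrt (b ^+ 2 - a)]. All values of [t] lie in [[b - s, b + s]], and the mean
of [t] for the normalized cone-volume measure of [L] is [b], the midpoint of
this interval. Bounding the concave function [ln] from below by its chord
([ln_ge_affine]), the mean of [ln t] is at least
[(ln (b - s) + ln (b + s)) / 2 = ln a / 2]; this is the logarithmic Minkowski
inequality for [K] and [L]. On the other hand [hK * rK / (hL * rL)] has mean
[a], so by Jensen's inequality the mean of its logarithm is at most [ln a].
Subtracting, the mean of [ln (rL / rK)] is at least [- ln a / 2], which is the
claim: [curvature_entropy_inequality]. Equality forces [t] to be an end of the
interval at every angle, hence constant, and support functions determine convex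
bodies.

The rest of the proof connects this with the geometric definitions. A boundary
point of positive curvature lies on a boundary curve whose tangent angle is a
local coordinate; following the point with a given normal along it shows that
[h] is twice differentiable and that the point with normal [dir th] moves with
velocity [r th] ([local_gauss], [body_support_derive], [gauss_derive]). In
particular this point is unique and the curvature does not depend on the
parametrization. The area formula [area_support] comes from Fubini's
construction of the product measure, the upper boundary arc being a graph that
is parametrized by the angle. Finally [cone_volume_integral] rewrites integrals
against the cone-volume measure as integrals over a period. *)

Set Implicit Arguments.
Unset Strict Implicit.
Unset Printing Implicit Defensive.

Import Order.TTheory GRing.Theory Num.Theory.
Import numFieldNormedType.Exports.

Local Open Scope ring_scope.
Local Open Scope classical_set_scope.

(** * Primitives of continuous functions *)

Section calculus.
Variable R : realType.
Implicit Types (f g F : R -> R) (a b c x : R).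
Local Notation mu := (@lebesgue_measure R).

Lemma is_derive_continuous f x (l : R) : is_derive x 1 f l -> {for x, continuous f}.
Proof.
by move=> [/derivable1_diffP df _]; exact: differentiable_continuous.
Qed.

Lemma mean_value f df a b : a <= b ->
    (forall x, a <= x <= b -> is_derive x 1 f (df x)) ->
  exists2 c, a <= c <= b & f b - f a = df c * (b - a).
Proof.
move=> ab dfP; have [||c] := @MVT_segment R f df a b ab; last by exists c.
- by move=> x /itvP xab; apply: dfP; rewrite !xab.
- apply: continuous_in_subspaceT => x; rewrite inE/= in_itv/= => xab.
  exact: is_derive_continuous (dfP x xab).
Qed.

Lemma continuous_integrable f a b : continuous f ->
  mu.-integrable `[a, b] (EFin \o f).
Proof.
move=> cf; apply: continuous_compact_integrable; first exact: segment_compact.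
exact: continuous_subspaceT.
Qed.

(** The antiderivative vanishing at [0] on the whole line, so that integrals over
translated periods can be compared. *)
Definition primitive f x : R :=
  if 0 <= x then \int[mu]_(t in `[0, x]) f t else - \int[mu]_(t in `[x, 0]) f t.

Lemma integral_split f a b c : continuous f -> a <= b -> b <= c ->
  \int[mu]_(t in `[a, c]) f t =
  \int[mu]_(t in `[a, b]) f t + \int[mu]_(t in `[b, c]) f t.
Proof.
move=> cf ab bc; apply/eqP; rewrite addrC -subr_eq; apply/eqP.
rewrite Rintegral_itvB ?bnd_simp//; last exact: continuous_integrable.
rewrite Rintegral_itv_obnd_cbnd//.
by apply: (integrableS _ _ _ (continuous_integrable b c cf)) => //;
  exact: subset_itv_oc_cc.
Qed.

(** Left of [0] the sign convention makes the two cases of [primitive] agree with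
one integral based at any [c] below both [0] and [x]; near a given point this is
the form to which the fundamental theorem of calculus applies. *)
Lemma primitiveE f c x : continuous f -> c <= 0 -> c <= x ->
  primitive f x = \int[mu]_(t in `[c, x]) f t - \int[mu]_(t in `[c, 0]) f t.
Proof.
move=> cf c0 cx; rewrite /primitive; case: (leP 0 x) => x0.
  by rewrite (integral_split cf c0 x0) addrC addKr.
by rewrite (integral_split cf cx (ltW x0)) opprD addrA subrr sub0r.
Qed.

Lemma integral_primitive f a b : continuous f -> a <= b ->
  \int[mu]_(t in `[a, b]) f t = primitive f b - primitive f a.
Proof.
move=> cf ab; pose c := Num.min a 0.
have c0 : c <= 0 by rewrite ge_min lexx orbT.
have ca : c <= a by rewrite ge_min lexx.
rewrite !(@primitiveE f c)// ?(le_trans ca)//.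
by rewrite (integral_split cf ca ab); ring.
Qed.

Lemma is_derive_primitive f x : continuous f -> is_derive x 1 (primitive f) (f x).
Proof.
move=> cf; pose c := Num.min x 0 - 1.
have cx : c < x by rewrite ltrBlDr (@le_lt_trans _ _ x)// ?ge_min ?lexx// ltrDl.
have c0 : c < 0 by rewrite ltrBlDr (@le_lt_trans _ _ 0)// ?ge_min ?lexx ?orbT// ltrDl.
have [dF F'] := @continuous_FTC1_closed R f c x (x + 1) (ltr_pwDr ltr01 (lexx x))
  (continuous_integrable _ _ cf) cx (cf x).
pose k := \int[mu]_(t in `[c, 0]) f t.
have dF1 : is_derive x 1 (fun x => \int[mu]_(t in `[c, x]) f t) (f x).
  by apply: (DeriveDef dF); rewrite -derive1E.
have dG := is_deriveB dF1 (is_derive_cst k x 1); rewrite subr0 in dG.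
apply: near_eq_is_derive dG.
near=> y; apply/esym; rewrite (@primitiveE f c)//; first exact: ltW.
by apply/ltW; near: y; exact: lt_nbhsr.
Unshelve. all: by end_near. Qed.

End calculus.

(** * Differentiation rules *)

Section derivatives.
Variable R : realType.
Implicit Types (f g : R -> R) (x l k c : R).

Lemma is_derive_add f g x l k : is_derive x 1 f l -> is_derive x 1 g k ->
  is_derive x 1 (fun y => f y + g y) (l + k).
Proof. exact: is_deriveD. Qed.

Lemma is_derive_opp f x l : is_derive x 1 f l ->
  is_derive x 1 (fun y => - f y) (- l).
Proof. exact: is_deriveN. Qed.

Lemma is_derive_sub f g x l k : is_derive x 1 f l -> is_derive x 1 g k ->
  is_derive x 1 (fun y => f y - g y) (l - k).
Proof. exact: is_deriveB. Qed.

Lemma is_derive_mul f g x l k : is_derive x 1 f l -> is_derive x 1 g k ->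
  is_derive x 1 (fun y => f y * g y) (l * g x + f x * k).
Proof.
move=> fl gk; apply: (is_derive_eq (is_deriveM fl gk)).
by rewrite /GRing.scale/=; ring.
Qed.

Lemma is_derive_scale c f x l : is_derive x 1 f l ->
  is_derive x 1 (fun y => c * f y) (c * l).
Proof. exact: is_deriveZ. Qed.

Lemma is_derive_comp f g x l k : is_derive x 1 g k -> is_derive (g x) 1 f l ->
  is_derive x 1 (fun y => f (g y)) (l * k).
Proof.
move=> gk fl; have [dg <-] := gk; have [df <-] := fl.
apply: DeriveDef; last by rewrite -!derive1E derive1_comp.
exact/derivable1_diffP/differentiable_comp/derivable1_diffP/df/derivable1_diffP/dg.
Qed.

Lemma is_derive_unique f x l k : is_derive x 1 f l -> is_derive x 1 f k -> l = k.
Proof. by move=> [_ <-] [_ <-]. Qed.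

Lemma is_derive_div f g x l k : g x != 0 ->
    is_derive x 1 f l -> is_derive x 1 g k ->
  is_derive x 1 (fun y => f y / g y) ((l * g x - f x * k) / g x ^+ 2).
Proof.
move=> g0 fl gk; apply: (is_derive_eq (is_derive_mul fl (is_deriveV g0 gk))).
by rewrite /GRing.scale/=; field.
Qed.

Lemma is_derive_addr x c : is_derive x 1 (fun y => y + c) 1.
Proof.
apply: (is_derive_eq (is_derive_add (is_derive_id x 1) (is_derive_cst c x 1))).
exact: addr0.
Qed.

Lemma is_derive_continuousT f df : (forall x, is_derive x 1 f (df x)) ->
  continuous f.
Proof. by move=> fd x; exact: is_derive_continuous (fd x). Qed.

Lemma continuous_mul f g : continuous f -> continuous g ->
  continuous (fun x => f x * g x).
Proof. by move=> cf cg x; apply: continuousM; [exact: cf|exact: cg]. Qed.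

(** Both [df] and its translate are derivatives of the same function. *)
Lemma derive_periodic f df p : (forall x, is_derive x 1 f (df x)) ->
  periodic f p -> periodic df p.
Proof.
move=> fd fp x; apply: (@is_derive_unique f x) => //.
have := is_derive_comp (is_derive_addr x p) (fd (x + p)).
by rewrite mulr1 (_ : (fun y => f (y + p)) = f)//; apply/funext.
Qed.

End derivatives.

(** * Wirtinger's inequality *)

Section wirtinger.
Variable R : realType.
Implicit Types (f g : R -> R) (x c : R).
Local Notation mu := (@lebesgue_measure R).

Lemma segment_integral_ge0 f a b : (forall x, 0 <= f x) ->
  0 <= \int[mu]_(t in `[a, b]) f t.
Proof. by move=> f0; apply: Rintegral_ge0. Qed.

Lemma segment_integralB f g (k : R) a b : continuous f -> continuous g ->
  \int[mu]_(t in `[a, b]) (f t - k * g t) =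
  \int[mu]_(t in `[a, b]) f t - k * \int[mu]_(t in `[a, b]) g t.
Proof.
move=> cf cg; rewrite RintegralB//; last 2 first.
- exact: continuous_integrable.
- by apply: (@continuous_integrable _ (fun t => k * g t)) => x; apply: cvgMr; exact: cg.
by rewrite RintegralZl//; exact: continuous_integrable.
Qed.

(** Completing the square: with [m] the midpoint and [0 < l < 1],
[df^2 - l^2 f^2 + (l f^2 tan (l (x - m)))' = (df + l f tan (l (x - m)))^2 >= 0].
Since [l < 1] the tangent is smooth on the closed interval, and its boundary
contributions vanish with [f]; then let [l] tend to [1]. *)
Lemma wirtinger f df c : (forall x, is_derive x 1 f (df x)) ->
    continuous df -> f c = 0 -> f (c + pi) = 0 ->
  \int[mu]_(t in `[c, c + pi]) (f t ^+ 2) <=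
  \int[mu]_(t in `[c, c + pi]) (df t ^+ 2).
Proof.
move=> fd cdf fc0 fcpi0; have cf := is_derive_continuousT fd.
have pi0 := pi_gt0 R.
have cpi : c <= c + pi by rewrite lerDl ltW.
have cf2 : continuous (fun t => f t ^+ 2) by exact: continuous_mul.
have cdf2 : continuous (fun t => df t ^+ 2) by exact: continuous_mul.
set B := (X in X <= _); set A := (X in _ <= X).
have le_lam (l : R) : 0 < l < 1 -> l ^+ 2 * B <= A.
  move=> /andP[l0 l1]; pose m := c + pi / 2.
  pose g t := df t ^+ 2 - l ^+ 2 * f t ^+ 2.
  have cg : continuous g.
    by move=> x; apply: cvgB; [exact: cdf2|apply: cvgMr; exact: cf2].
  have cos0 x : c <= x <= c + pi -> cos (l * (x - m)) != 0.
    move=> /andP[cx xc]; rewrite gt_eqF// cos_gt0_pihalf// /m.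
    have h1 : - (pi / 2) <= x - (c + pi / 2) by lra.
    have h2 : x - (c + pi / 2) <= pi / 2 by lra.
    by apply/andP; split; nra.
  pose D x := primitive g x + l * (f x ^+ 2 * tan (l * (x - m))).
  have [|y _] := @mean_value R D
      (fun x => (df x + l * (f x * tan (l * (x - m)))) ^+ 2) c (c + pi) cpi.
    move=> x cxc.
    have dl : is_derive x 1 (fun x => l * (x - m)) (l * 1).
      exact/is_derive_scale/is_derive_addr.
    have dt := is_derive_comp dl (is_derive_tan (cos0 x cxc)).
    have dD := is_derive_add (is_derive_primitive x cg)
      (is_derive_scale l (is_derive_mul (is_derive_mul (fd x) (fd x)) dt)).
    apply: (is_derive_eq dD); rewrite cos2_tan2; last exact: cos0.
    by rewrite /g; ring.
  rewrite /D fc0 fcpi0 expr0n/= !mul0r mulr0 !addr0.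
  rewrite -integral_primitive// segment_integralB//.
  by rewrite -subr_ge0 => ->; rewrite addrAC subrr add0r mulr_ge0 ?sqr_ge0 ?ltW.
have A0 : 0 <= A by apply: segment_integral_ge0 => x; exact: sqr_ge0.
rewrite leNgt; apply/negP => AB.
have B0 : 0 < B by exact: le_lt_trans AB.
pose q := A / B; have q0 : 0 <= q by rewrite divr_ge0// ltW.
have q1 : q < 1 by rewrite ltr_pdivrMr// mul1r.
have AE : A = q * B by rewrite divfK// gt_eqF.
(* [l ^+ 2 > 2 * l - 1 = q] for this [l]. *)
have := le_lam ((1 + q) / 2); rewrite AE ler_pM2r// => H.
have /H : 0 < (1 + q) / 2 < 1 by lra.
have : 0 < (1 - q) ^+ 2 by rewrite exprn_gt0// subr_gt0.
by nra.
Qed.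

End wirtinger.

(** * Integrals over a period *)

Section period.
Variable R : realType.
Implicit Types (f g : R -> R) (x c k : R).
Local Notation mu := (@lebesgue_measure R).

Definition period_integral f : R := \int[mu]_(t in `[0, 2 * pi]) f t.
Local Notation I := period_integral.

Lemma pi2_ge0 : 0 <= 2 * pi :> R.
Proof. by rewrite mulr_ge0// pi_ge0. Qed.

Lemma period_integralD f g : continuous f -> continuous g ->
  I (fun x => f x + g x) = I f + I g.
Proof. by move=> cf cg; rewrite /I RintegralD//; exact: continuous_integrable. Qed.

Lemma period_integralZ k f : continuous f -> I (fun x => k * f x) = k * I f.
Proof. by move=> cf; rewrite /I RintegralZl//; exact: continuous_integrable. Qed.

Lemma period_integralB f g : continuous f -> continuous g ->
  I (fun x => f x - g x) = I f - I g.
Proof. by move=> cf cg; rewrite /I RintegralB//; exact: continuous_integrable. Qed.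

(** The difference between the two sides has derivative [0] in [c]. *)
Lemma primitive_shift f p c : continuous f -> periodic f p ->
  primitive f (c + p) - primitive f c = primitive f p - primitive f 0.
Proof.
move=> cf fper; pose D x := primitive f (x + p) - primitive f x.
have dD x : is_derive x 1 D 0.
  have := is_derive_sub
    (is_derive_comp (is_derive_addr x p) (is_derive_primitive _ cf))
    (is_derive_primitive x cf).
  by rewrite fper mulr1 subrr.
by have := is_derive_0_is_cst c 0 dD; rewrite /D add0r.
Qed.

Lemma period_integral_shift f c : continuous f -> periodic f (2 * pi) ->
  I f = primitive f (c + 2 * pi) - primitive f c.
Proof.
by move=> cf fper; rewrite /I integral_primitive ?pi2_ge0// primitive_shift.
Qed.

Lemma period_integral_double f : continuous f -> periodic f pi ->
  I f = 2 * \int[mu]_(t in `[0, pi]) f t.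
Proof.
move=> cf fper; rewrite /I !integral_primitive ?pi2_ge0 ?pi_ge0//.
rewrite [in LHS]mulr_natl mulr2n.
by have := primitive_shift pi cf fper; move: (primitive f (pi + pi)) => z E; lra.
Qed.

Lemma period_integral_derive f df : (forall x, is_derive x 1 f (df x)) ->
  continuous df -> periodic f (2 * pi) -> I df = 0.
Proof.
move=> fd cdf fper.
pose D x := primitive df x - f x.
have dD x : is_derive x 1 D 0.
  by have := is_derive_sub (is_derive_primitive x cdf) (fd x); rewrite subrr.
rewrite /I integral_primitive ?pi2_ge0//.
have := is_derive_0_is_cst 0 (2 * pi) dD; rewrite /D.
by have := fper 0; rewrite add0r => ->; lra.
Qed.

Lemma period_integral_ge0 f : (forall x, 0 <= f x) -> 0 <= I f.
Proof. exact: segment_integral_ge0. Qed.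

(** The primitive of [f] is nondecreasing and takes the same value at both ends
of a period centred at [x], hence is constant on it. *)
Lemma period_integral_eq0 f x : continuous f -> periodic f (2 * pi) ->
  (forall x, 0 <= f x) -> I f = 0 -> f x = 0.
Proof.
move=> cf fper f0 If0.
have G_le a b : a <= b -> primitive f a <= primitive f b.
  by move=> ab; rewrite -subr_ge0 -integral_primitive// segment_integral_ge0.
pose a := x - pi; pose b := a + 2 * pi.
have [xa xb] : a < x /\ x < b.
  by have := pi_gt0 R; rewrite /b /a; split; lra.
have Gab : primitive f b = primitive f a.
  by apply/eqP; rewrite -subr_eq0 -period_integral_shift// If0.
apply: (@is_derive_unique _ (primitive f) x).
  exact: is_derive_primitive.
apply: (near_eq_is_derive _ (is_derive_cst (primitive f a) x 1)).
near=> y; have [ay yb] : a <= y /\ y <= b.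
  by split; apply/ltW; near: y; [exact: lt_nbhsr|exact: lt_nbhsl].
by apply/eqP; rewrite eq_le G_le//= -Gab G_le.
Unshelve. all: by end_near. Qed.

Lemma period_integral_gt0 f : continuous f -> periodic f (2 * pi) ->
  (forall x, 0 < f x) -> 0 < I f.
Proof.
move=> cf fper f0; have f0' x := ltW (f0 x).
rewrite lt_neqAle period_integral_ge0// andbT eq_sym; apply/eqP => If.
by have := f0 0; rewrite (period_integral_eq0 0 cf fper f0' If) ltxx.
Qed.

End period.

(** * Chords of the logarithm *)

Section log_chord.
Variable R : realType.
Implicit Types (a b p q s t x : R).

Lemma ln_lt_subr1 x : 0 < x -> x != 1 -> ln x < x - 1.
Proof.
move=> x0 x1; have lx0 : ln x != 0 by rewrite ln_eq0.
by have := expR_gt1Dx lx0; rewrite lnK ?posrE//; lra.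
Qed.

Lemma ln_le_subr1 x : 0 < x -> ln x <= x - 1.
Proof.
move=> x0; have [->|x1] := eqVneq x 1; first by rewrite ln1 subrr.
exact/ltW/ln_lt_subr1.
Qed.

(** Strict concavity of [ln] in the form of the tangent inequality at [t]:
[ln (p / t) < p / t - 1] and [ln (q / t) < q / t - 1], averaged with weights
that cancel the right-hand sides. *)
Lemma ln_gt_chord p q t : 0 < p -> p < t -> t < q ->
  (q - t) * ln p + (t - p) * ln q < (q - p) * ln t.
Proof.
move=> p0 pt tq; have t0 : 0 < t by lra.
have q0 : 0 < q by lra.
have hp : ln p < ln t + (p / t - 1).
  rewrite -ltrBlDl -ln_div ?posrE// ln_lt_subr1 ?divr_gt0//.
  by rewrite lt_eqF// ltr_pdivrMr// mul1r.
have hq : ln q < ln t + (q / t - 1).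
  rewrite -ltrBlDl -ln_div ?posrE// ln_lt_subr1 ?divr_gt0//.
  by rewrite gt_eqF// ltr_pdivlMr// mul1r.
have -> : (q - p) * ln t =
    (q - t) * (ln t + (p / t - 1)) + (t - p) * (ln t + (q / t - 1)).
  by field; rewrite gt_eqF.
by rewrite ltrD// ltr_pM2l// subr_gt0.
Qed.

(** The quadratic condition says that [t] lies between [b - s] and [b + s], where
[s ^+ 2 = b ^+ 2 - a]. The affine function is the chord of [ln] over this
interval; as the product of the two ends is [a], its value at the midpoint [b]
is [ln a / 2]. A random [t] with mean [b] therefore has [E (ln t) >= ln a / 2]. *)
Lemma ln_ge_affine a b : 0 < a -> 0 < b -> a <= b ^+ 2 ->
  exists k, forall t, 0 < t -> t ^+ 2 - 2 * b * t + a <= 0 ->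
    ln a / 2 + k * (t - b) <= ln t /\
    (ln t = ln a / 2 + k * (t - b) -> (t - b) ^+ 2 = b ^+ 2 - a).
Proof.
move=> a0 b0 ab; pose s := Num.sqrt (b ^+ 2 - a).
have s2 : s ^+ 2 = b ^+ 2 - a by rewrite sqr_sqrtr// subr_ge0.
have s0 : 0 <= s by exact: sqrtr_ge0.
have lnaE : 0 < b - s -> ln a = ln (b - s) + ln (b + s).
  move=> p0; rewrite -lnM ?posrE//; last by lra.
  by congr ln; rewrite -subr_sqr s2; ring.
have sb : s < b by rewrite -ltr_sqr ?nnegrE ?(ltW b0)// s2; lra.
have {}lnaE := lnaE ltac:(lra).
have [s_eq0|s_neq0] := eqVneq s 0.
  exists 0 => t t0 ht; have tb : t = b.
    by apply/eqP; rewrite -subr_eq0 -sqrf_eq0 eq_le sqr_ge0 andbT; nra.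
  have -> : ln a = 2 * ln b by rewrite lnaE s_eq0 subr0 addr0; ring.
  by rewrite tb subrr -s2 s_eq0; split=> [|_]; [lra|ring].
have {}s0 : 0 < s by rewrite lt_def s_neq0.
pose k := (ln (b + s) - ln (b - s)) / (2 * s).
have kE t : ln a / 2 + k * (t - b) =
    ((b + s - t) * ln (b - s) + (t - (b - s)) * ln (b + s)) / (2 * s).
  by rewrite lnaE /k; field.
exists k => t t0 ht.
have abs_tb : `|t - b| <= s.
  rewrite -ler_sqr ?nnegrE ?normr_ge0 ?(ltW s0)// real_normK ?num_real// s2.
  have -> : (t - b) ^+ 2 = t ^+ 2 - 2 * b * t + b ^+ 2 by ring.
  by lra.
have [ts|ts] := eqVneq `|t - b| s.
  have -> : (t - b) ^+ 2 = b ^+ 2 - a by rewrite -s2 -ts real_normK ?num_real.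
  split=> //; rewrite kE.
  have [tE|tE] : t = b + s \/ t = b - s.
    case: (leP 0 (t - b)) => tb.
      by left; rewrite -ts ger0_norm//; lra.
    by right; rewrite -ts ltr0_norm//; lra.
  - rewrite {1 2}tE -tE subrr mul0r add0r.
    have -> : t - (b - s) = 2 * s by rewrite tE; ring.
    by rewrite mulrAC divff ?mul1r// mulf_neq0.
  - rewrite {1 2}tE -tE subrr mul0r addr0.
    have -> : b + s - t = 2 * s by rewrite tE; ring.
    by rewrite mulrAC divff ?mul1r// mulf_neq0.
have {abs_tb} : `|t - b| < s by rewrite lt_neqAle ts.
rewrite ltr_distl => /andP[pt tq].
have p0 : 0 < b - s by lra.
have := ln_gt_chord p0 pt tq.
have -> : b + s - (b - s) = 2 * s by ring.
rewrite -ltr_pdivrMl; last by lra.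
rewrite mulrC -kE => lt_ln; split; first exact: ltW.
by move=> E; rewrite E ltxx in lt_ln.
Qed.

End log_chord.

(** * The inequality for support functions *)

Section curvature_entropy.
Variable R : realType.
Implicit Types (h dh r : R -> R) (x c k t : R).
Local Notation mu := (@lebesgue_measure R).
Local Notation I := (@period_integral R).

(** [h] is the support function of an origin-symmetric body as a function of the
angle, [dh] its derivative and [r] the radius of curvature [h + h'']; symmetry
of the body is the period [pi]. *)
Definition smooth_support h dh r : Prop :=
  [/\ forall x, is_derive x 1 h (dh x),
      forall x, is_derive x 1 dh (r x - h x),
      continuous r,
      forall x, 0 < h x /\ 0 < r x
    & periodic h pi].

Lemma periodic_double (f : R -> R) p : periodic f p -> periodic f (2 * p).
Proof. by move=> fp x; rewrite mulr_natl periodicn. Qed.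

Lemma continuous_ln_comp (f : R -> R) : (forall x, 0 < f x) -> continuous f ->
  continuous (fun x => ln (f x)).
Proof.
by move=> f0 cf x; apply: continuous_comp; [exact: cf|exact: continuous_ln].
Qed.

Lemma continuous_div (f g : R -> R) : (forall x, 0 < g x) ->
  continuous f -> continuous g -> continuous (fun x => f x / g x).
Proof.
move=> g0 cf cg; apply: continuous_mul => // x.
by apply: cvgV; [rewrite gt_eqF|exact: cg].
Qed.

Section one_body.
Variables h dh r : R -> R.
Hypothesis hS : smooth_support h dh r.

Lemma smooth_supportP : [/\ continuous h, continuous dh, periodic dh pi,
  periodic r pi & forall x, 0 < h x * r x].
Proof.
have [hd dhd cr h_gt0 hp] := hS; have dhp := derive_periodic hd hp.
split=> //; [exact: is_derive_continuousT hd|exact: is_derive_continuousT dhd| |].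
  by move=> x; have := derive_periodic dhd dhp x; rewrite hp; lra.
by move=> x; have [h0 r0] := h_gt0 x; exact: mulr_gt0.
Qed.

End one_body.

Section two_bodies.
Variables hK dhK rK hL dhL rL : R -> R.
Hypothesis KS : smooth_support hK dhK rK.
Hypothesis LS : smooth_support hL dhL rL.

(** The integrands differ by the derivative of [hK * dhL - hL * dhK]. *)
Lemma mixed_area_sym : I (fun x => hK x * rL x) = I (fun x => hL x * rK x).
Proof.
have [hKd dhKd crK _ hKp] := KS; have [chK cdhK dhKp rKp _] := smooth_supportP KS.
have [hLd dhLd crL _ hLp] := LS; have [chL cdhL dhLp rLp _] := smooth_supportP LS.
have cKL := continuous_mul chK crL; have cLK := continuous_mul chL crK.
apply/eqP; rewrite -subr_eq0 -period_integralB//; apply/eqP.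
apply: (@period_integral_derive _ (fun x => hK x * dhL x - hL x * dhK x)).
- move=> x.
  have := is_derive_sub (is_derive_mul (hKd x) (dhLd x))
    (is_derive_mul (hLd x) (dhKd x)).
  by move/is_derive_eq; apply; ring.
- by move=> x; apply: cvgB; [exact: cKL|exact: cLK].
- by apply: periodic_double => x; rewrite hKp hLp dhKp dhLp.
Qed.

(** A Bonnesen-type inequality. The left-hand side is the integral of
[f * (f + f'')], that is of [f ^+ 2 - f' ^+ 2], for [f = hK - t * hL]. This
function vanishes at [c] by the choice of [t] and at [c + pi], [c + 2 * pi] by
symmetry, so Wirtinger's inequality applies on both half-periods. *)
Lemma bonnesen c (t := hK c / hL c) :
  I (fun x => hK x * rK x) - 2 * t * I (fun x => hK x * rL x)
    + t ^+ 2 * I (fun x => hL x * rL x) <= 0.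
Proof.
have [hKd dhKd crK _ hKp] := KS; have [chK cdhK dhKp rKp _] := smooth_supportP KS.
have [hLd dhLd crL hL0 hLp] := LS.
have [chL cdhL dhLp rLp _] := smooth_supportP LS.
pose f x := hK x - t * hL x; pose df x := dhK x - t * dhL x.
pose q x := rK x - t * rL x.
have fd x : is_derive x 1 f (df x).
  exact: (is_derive_sub (hKd x) (is_derive_scale t (hLd x))).
have dfd x : is_derive x 1 df (q x - f x).
  apply: (is_derive_eq (is_derive_sub (dhKd x) (is_derive_scale t (dhLd x)))).
  by rewrite /q /f; ring.
have cf := is_derive_continuousT fd; have cdf := is_derive_continuousT dfd.
have cq : continuous q.
  by move=> x; apply: cvgB; [exact: crK|apply: cvgMr; exact: crL].
have fp : periodic f pi by move=> x; rewrite /f hKp hLp.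
have dfp : periodic df pi by move=> x; rewrite /df dhKp dhLp.
have cf2 := continuous_mul cf cf; have cdf2 := continuous_mul cdf cdf.
have cfq := continuous_mul cf cq.
have fc : f c = 0.
  by rewrite /f /t divfK ?subrr// gt_eqF//; have [] := hL0 c.
have If_le : I (fun x => f x * f x) <= I (fun x => df x * df x).
  have W d : f d = 0 -> \int[mu]_(t in `[d, d + pi]) (f t * f t) <=
      \int[mu]_(t in `[d, d + pi]) (df t * df t).
    by move=> fd0; apply: (@wirtinger _ f df d fd cdf); rewrite ?fp.
  have split (g : R -> R) : continuous g -> periodic g pi ->
      I g = \int[mu]_(t in `[c, c + pi]) g t +
            \int[mu]_(t in `[c + pi, c + pi + pi]) g t.
    move=> cg gp; rewrite (period_integral_shift c cg (periodic_double gp)).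
    rewrite -integral_split ?lerDl ?pi_ge0// integral_primitive//; last first.
      by rewrite -addrA lerDl addr_ge0 ?pi_ge0.
    by rewrite -addrA -mulr2n mulr_natl.
  rewrite !split//; [|by move=> x; rewrite dfp|by move=> x; rewrite fp].
  by apply: lerD; apply: W; rewrite ?fp.
have parts : I (fun x => df x * df x + (f x * q x - f x * f x)) = 0.
  apply: (@period_integral_derive _ (fun x => f x * df x)).
  - move=> x; apply: (is_derive_eq (is_derive_mul (fd x) (dfd x))); ring.
  - move=> x; apply: cvgD; [exact: cdf2|].
    by apply: cvgB; [exact: cfq|exact: cf2].
  - by apply: periodic_double => x; rewrite fp dfp.
rewrite period_integralD// ?period_integralB// in parts; last first.
  by move=> x; apply: cvgB; [exact: cfq|exact: cf2].
have : I (fun x => f x * q x) <= 0 by lra.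
have cKK := continuous_mul chK crK; have cKL := continuous_mul chK crL.
have cLK := continuous_mul chL crK; have cLL := continuous_mul chL crL.
have -> : (fun x => f x * q x) = (fun x => (hK x * rK x - t * (hK x * rL x))
    - (t * (hL x * rK x) - t ^+ 2 * (hL x * rL x))).
  by apply/funext => x; rewrite /f /q; ring.
have cZ k (g : R -> R) : continuous g -> continuous (fun x => k * g x).
  by move=> cg x; apply: cvgMr; exact: cg.
have cB (g g' : R -> R) : continuous g -> continuous g' ->
    continuous (fun x => g x - g' x).
  by move=> cg cg' x; apply: cvgB; [exact: cg|exact: cg'].
rewrite !(period_integralB, period_integralZ)//; do ?[exact: cZ|exact: cB];
  [|by apply: cB => //; exact: cZ|by apply: cB; exact: cZ].
by rewrite -mixed_area_sym; lra.
Qed.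

End two_bodies.
End curvature_entropy.

Section entropy_inequality.
Variable R : realType.
Local Notation I := (@period_integral R).
Variables hK dhK rK hL dhL rL : R -> R.
Hypothesis KS : smooth_support hK dhK rK.
Hypothesis LS : smooth_support hL dhL rL.

Let AK := I (fun x => hK x * rK x) / 2.
Let AL := I (fun x => hL x * rL x) / 2.

Definition curvature_entropy : R :=
  I (fun x => ln (rL x / rK x) * (hL x * rL x / 2)) + AL / 2 * ln (AK / AL).

(** Write [t = hK / hL], [w = hL * rL], [a = AK / AL] and [b = B / AL], with [B]
the mixed area. By [bonnesen], [t ^+ 2 - 2 * b * t + a <= 0] at every angle, so
[ln_ge_affine] bounds [ln t] from below by a chord, while
[ln y <= y - 1] bounds [ln] of [y = t * rK / (rL * a)] from above. As
[rL / rK = t / (a * y)], the integrand is at least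
[(chord t - ln a - (y - 1)) * w / 2]; the integral of this bound depends only on
the integrals of [w], [t * w] and [y * w], which are [2 AL], [2 B] and [2 AL],
and equals [- AL / 2 * ln a]. So the entropy is the integral of the nonnegative
function [defect]. If it vanishes, [t] is everywhere an end of the chord, that
is [(t - b) ^+ 2] is constant, and a differentiable such [t] is constant. *)
Lemma curvature_entropy_inequality : 0 <= curvature_entropy /\
  (curvature_entropy = 0 -> exists2 c, 0 < c & forall x, hK x = c * hL x).
Proof.
have [hKd dhKd crK hK0 hKp] := KS.
have [chK cdhK dhKp rKp wK0] := smooth_supportP KS.
have [hLd dhLd crL hL0 hLp] := LS.
have [chL cdhL dhLp rLp wL0] := smooth_supportP LS.
have cKK := continuous_mul chK crK; have cKL := continuous_mul chK crL.
have cLL := continuous_mul chL crL.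
pose B := I (fun x => hK x * rL x) / 2.
have AK0 : 0 < AK.
  rewrite divr_gt0// period_integral_gt0//.
  by apply: periodic_double => x; rewrite hKp rKp.
have AL0 : 0 < AL.
  rewrite divr_gt0// period_integral_gt0//.
  by apply: periodic_double => x; rewrite hLp rLp.
have B0 : 0 < B.
  rewrite divr_gt0// period_integral_gt0//.
    by apply: periodic_double => x; rewrite hKp rLp.
  by move=> x; have [? _] := hK0 x; have [_ ?] := hL0 x; exact: mulr_gt0.
pose a := AK / AL; pose b := B / AL; pose t x := hK x / hL x.
have a0 : 0 < a by exact: divr_gt0.
have b0 : 0 < b by exact: divr_gt0.
have t0 x : 0 < t x by have [? _] := hK0 x; have [? _] := hL0 x; exact: divr_gt0.
have Q x : t x ^+ 2 - 2 * b * t x + a <= 0.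
  have /= := bonnesen KS LS x; rewrite -/(t x) => H.
  rewrite -(ler_pM2r AL0) mul0r /a /b.
  have -> : (t x ^+ 2 - 2 * (B / AL) * t x + AK / AL) * AL =
      t x ^+ 2 * AL - 2 * t x * B + AK by field; rewrite gt_eqF.
  by rewrite /AL /AK /B; lra.
have ab : a <= b ^+ 2.
  move: (t 0) (Q 0) => z Qz; have := sqr_ge0 (z - b).
  have -> : (z - b) ^+ 2 = z ^+ 2 - 2 * b * z + b ^+ 2 by ring.
  by move: Qz; clear; lra.
have [k lnP] := ln_ge_affine a0 b0 ab.
pose y x := t x * (rK x / rL x) / a.
have y0 x : 0 < y x.
  have [_ ?] := hK0 x; have [_ ?] := hL0 x.
  by rewrite divr_gt0// mulr_gt0// divr_gt0.
have lnE x : ln (rL x / rK x) = ln (t x) - (ln (y x) + ln a).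
  have [_ ?] := hK0 x; have [_ ?] := hL0 x; have [? _] := hL0 x.
  have := t0 x => tx0.
  have rr : 0 < rK x / rL x by exact: divr_gt0.
  have txr : 0 < t x * (rK x / rL x) by exact: mulr_gt0.
  have -> : ln (y x) = ln (t x * (rK x / rL x)) - ln a.
    by rewrite -ln_div ?posrE.
  by rewrite -(invf_div (rK x) (rL x)) lnV ?posrE// [ln (t x * _)]lnM ?posrE//; ring.
pose d1 x := ln (t x) - (ln a / 2 + k * (t x - b)).
pose d2 x := y x - 1 - ln (y x).
have d1_ge0 x : 0 <= d1 x by rewrite subr_ge0; have [] := lnP _ (t0 x) (Q x).
have d2_ge0 x : 0 <= d2 x by rewrite subr_ge0 ln_le_subr1.
pose defect x := (d1 x + d2 x) * (hL x * rL x / 2).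
have defect_ge0 x : 0 <= defect x.
  by apply: mulr_ge0; [exact: addr_ge0|apply: divr_ge0 => //; exact: ltW].
have rLK_gt0 x : 0 < rL x / rK x.
  by have [_ ?] := hK0 x; have [_ ?] := hL0 x; exact: divr_gt0.
have cmain : continuous (fun x => ln (rL x / rK x) * (hL x * rL x / 2)).
  apply: continuous_mul.
    apply: continuous_ln_comp => //; apply: continuous_div => //.
    by move=> x; have [] := hK0 x.
  by move=> x; apply: cvgMl; exact: cLL.
have cZ c (g : R -> R) : continuous g -> continuous (fun x => c * g x).
  by move=> cg x; apply: cvgMr; exact: cg.
have cD (g g' : R -> R) : continuous g -> continuous g' ->
    continuous (fun x => g x + g' x).
  by move=> cg cg' x; apply: cvgD; [exact: cg|exact: cg'].
have defectE : defect = fun x => ln (rL x / rK x) * (hL x * rL x / 2) +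
    ((ln a / 2 + k * b - 1) / 2 * (hL x * rL x) +
     ((- k / 2) * (hK x * rL x) + (2 * a)^-1 * (hK x * rK x))).
  apply/funext => x; have [_ ?] := hK0 x; have [? ?] := hL0 x.
  rewrite /defect /d1 /d2 lnE /y /t; field.
  by rewrite !gt_eqF.
have c1 := cZ (- k / 2) _ cKL; have c2 := cZ (2 * a)^-1 _ cKK.
have c3 := cZ ((ln a / 2 + k * b - 1) / 2) _ cLL.
have c12 := cD _ _ c1 c2; have c123 := cD _ _ c3 c12.
have IdefectE : I defect = curvature_entropy.
  rewrite defectE !(period_integralD, period_integralZ)//.
  rewrite /curvature_entropy -/a; congr (_ + _).
  rewrite (_ : I (fun x => hL x * rL x) = 2 * AL); last by rewrite /AL; lra.
  rewrite (_ : I (fun x => hK x * rL x) = 2 * B); last by rewrite /B; lra.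
  rewrite (_ : I (fun x => hK x * rK x) = 2 * AK); last by rewrite /AK; lra.
  rewrite (_ : B = b * AL); last by rewrite /b divfK// gt_eqF.
  rewrite (_ : AK = a * AL); last by rewrite /a divfK// gt_eqF.
  by field; rewrite gt_eqF.
have cdefect : continuous defect.
  by rewrite defectE; exact: cD.
rewrite -IdefectE; split; first exact: period_integral_ge0.
move=> Idefect0.
have defect0 x : defect x = 0.
  apply: period_integral_eq0 => //; apply: periodic_double => z.
  by rewrite defectE hLp hKp rLp rKp.
(* Where the chord of the logarithm is attained, [t] is one of its two ends. *)
have t_ends x : (t x - b) ^+ 2 = b ^+ 2 - a.
  have /eqP := defect0 x; rewrite mulf_eq0 => /orP[|]; last first.
    by rewrite gt_eqF// divr_gt0.
  rewrite paddr_eq0// => /andP[/eqP d10 _].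
  by have [_] := lnP _ (t0 x) (Q x); apply; move: d10; rewrite /d1; lra.
pose dt x := (dhK x * hL x - hK x * dhL x) / hL x ^+ 2.
have td (x : R) : is_derive x 1 t (dt x).
  by apply: is_derive_div; rewrite ?gt_eqF//; have [] := hL0 x.
have t_cst x : t x = t 0.
  have [s0|s0] := eqVneq (b ^+ 2 - a) 0.
    have tb z : t z = b.
      by apply/eqP; rewrite -subr_eq0 -sqrf_eq0 t_ends s0.
    by rewrite !tb.
  have dt0 z : dt z = 0.
    have tzb : is_derive z 1 (fun y => t y - b) (dt z) by apply: (is_derive_eq (is_derive_sub (td z) (is_derive_cst b z 1))); rewrite subr0.
    have E := is_derive_unique (is_derive_mul tzb tzb) _.
    have : dt z * (t z - b) + (t z - b) * dt z = 0.
      apply: E; rewrite (_ : (fun _ => _) = cst (b ^+ 2 - a)).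
        exact: is_derive_cst.
      by apply/funext => x'; exact: t_ends.
    have : t z - b != 0 by rewrite -sqrf_eq0 t_ends.
    move=> tb /eqP; rewrite mulrC -mulr2n mulrn_eq0/= mulf_eq0 (negPf tb)/=.
    by move/eqP.
  by apply: is_derive_0_is_cst => z; rewrite -(dt0 z).
exists (t 0) => // x; rewrite -(t_cst x) divfK// gt_eqF//.
by have [] := hL0 x.
Qed.

End entropy_inequality.

Section dilates.
Variable R : realType.
Local Notation I := (@period_integral R).
Variables hK dhK rK hL dhL rL : R -> R.
Hypothesis KS : smooth_support hK dhK rK.
Hypothesis LS : smooth_support hL dhL rL.

Lemma curvature_entropy_dilate c : 0 < c -> (forall x, hK x = c * hL x) ->
  curvature_entropy hK rK hL rL = 0.
Proof.
move=> c0 hKL; have [hKd dhKd _ _ _] := KS; have [hLd dhLd crL hL0 hLp] := LS.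
have [chL _ _ rLp wL0] := smooth_supportP LS.
have dhKL x : dhK x = c * dhL x.
  apply: (is_derive_unique (hKd x)).
  by rewrite (_ : hK = fun x => c * hL x); [exact: is_derive_scale|apply/funext].
have rKL x : rK x = c * rL x.
  have : rK x - hK x = c * (rL x - hL x).
    apply: (is_derive_unique (dhKd x)).
    by rewrite (_ : dhK = fun x => c * dhL x); [exact: is_derive_scale|apply/funext].
  by rewrite hKL; lra.
have cw := continuous_mul chL crL.
have Iw0 : 0 < I (fun x => hL x * rL x).
  apply: period_integral_gt0 => //.
  by apply: periodic_double => x; rewrite hLp rLp.
rewrite /curvature_entropy.
rewrite (_ : (fun x => ln (rL x / rK x) * (hL x * rL x / 2)) =
    fun x => (- ln c / 2) * (hL x * rL x)); last first.
  apply/funext => x; have [_ r0] := hL0 x.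
  rewrite rKL (_ : rL x / (c * rL x) = c^-1); last by field; rewrite !gt_eqF.
  by rewrite lnV ?posrE//; ring.
rewrite (_ : (fun x => hK x * rK x) = fun x => c ^+ 2 * (hL x * rL x)); last first.
  by apply/funext => x; rewrite hKL rKL; ring.
rewrite !period_integralZ//; set w := I _.
rewrite (_ : c ^+ 2 * w / 2 / (w / 2) = c ^+ 2); last by field; rewrite gt_eqF.
by rewrite lnXn// -[_ *+ 2]mulr_natr; field.
Qed.

End dilates.

(** * Planar convex sets and their supporting lines *)

Section convex_plane.
Variable R : realType.
Implicit Types (p q u v z : R * R) (K L : set (R * R)) (s t x : R).

Definition dir t : R * R := (cos t, sin t).

Definition supports K p t := forall q, K q -> dot q (dir t) <= dot p (dir t).

Lemma dotE p u : dot p u = p.1 * u.1 + p.2 * u.2. Proof. by []. Qed.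

Lemma dotDl p q u : dot (p + q) u = dot p u + dot q u.
Proof. by rewrite !dotE/=; ring. Qed.

Lemma dotBl p q u : dot (p - q) u = dot p u - dot q u.
Proof. by rewrite !dotE/=; ring. Qed.

Lemma dotNl p u : dot (- p) u = - dot p u.
Proof. by rewrite !dotE/=; ring. Qed.

Lemma dotZl s p u : dot (s *: p) u = s * dot p u.
Proof. by rewrite !dotE/= /GRing.scale/=; ring. Qed.

Lemma dot_dir_norm t : dot (dir t) (dir t) = 1.
Proof. by rewrite dotE/= -!expr2 cos2Dsin2. Qed.

Lemma continuous_dotl u : continuous (fun p => dot p u).
Proof.
by move=> p; apply: cvgD; apply: cvgMl; [exact: cvg_fst|exact: cvg_snd].
Qed.

Lemma convex_combination K p q s : convex_set K -> K p -> K q -> 0 <= s -> s <= 1 ->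
  K (s *: p + (1 - s) *: q).
Proof.
move=> cK Kp Kq s0 s1.
by have := cK p q (Itv01 s0 s1); rewrite !inE => /(_ Kp Kq).
Qed.

(** A right inverse of [dir] on the circle, with values in [- pi, pi]. *)
Definition angle u := if 0 <= u.2 then acos u.1 else - acos u.1.

Lemma circle_itv u : circle u -> -1 <= u.1 <= 1.
Proof.
case: u => a b; rewrite /circle/= dotE/= => ab1; rewrite -2!expr2 in ab1.
by apply/andP; split; nra.
Qed.

Lemma angleP u : circle u -> - pi <= angle u <= pi /\ dir (angle u) = u.
Proof.
move=> cu; have a1 := circle_itv cu; move: cu a1.
case: u => a b; rewrite /circle /angle/= dotE/= => ab1 a1; rewrite -2!expr2 in ab1.
have acos_le := acos_lepi a1; have acos_ge := acos_ge0 a1; have pi0 := pi_gt0 R.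
have sinE : sin (acos a) = `|b|.
  by rewrite sin_acos// -sqrtr_sqr -ab1 addrAC subrr add0r.
case: (leP 0 b) => b0; rewrite /dir ?cosN ?sinN acosK ?in_itv// sinE.
  by split; [lra|rewrite ger0_norm].
by split; [lra|rewrite ltr0_norm// opprK].
Qed.

Lemma circle_dir u : circle u -> exists2 t, - pi <= t <= pi & u = dir t.
Proof. by move=> /angleP[]; exists (angle u). Qed.

Lemma interior_push K z u : K° z -> exists2 s, 0 < s & K (z + s *: u).
Proof.
move=> Kz.
have cl : (fun s : R => z + s *: u) s @[s --> 0] --> z.
  have : (fun s : R => z + s *: u) s @[s --> 0] --> z + 0 *: u.
    by apply: cvgD; [exact: cvg_cst|apply: cvgZr_tmp; exact: cvg_id].
  by rewrite scale0r addr0.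
have Knear : \forall s \near (0 : R)^'+, K (z + s *: u).
  by apply: cvg_at_right_filter cl _ Kz.
near (0 : R)^'+ => s; exists s; first by [].
by near: s.
Unshelve. all: by end_near. Qed.

(** A linear functional has no maximum at an interior point. *)
Lemma interior_not_support K z t : K° z -> exists2 q, K q & dot z (dir t) < dot q (dir t).
Proof.
move=> /(interior_push (dir t))[s s0 Kzs]; exists (z + s *: dir t) => //.
by rewrite dotDl dotZl dot_dir_norm mulr1 ltrDl.
Qed.

Section compact_sets.
Variable K : set (R * R).
Hypotheses (cptK : compact K) (K0 : K !=set0).

Lemma support_attained u : exists2 p, K p & forall q, K q -> dot q u <= dot p u.
Proof.
have [|p] := compact_EVT_max K0 cptK (f := fun p => dot p u).
  exact/continuous_subspaceT/continuous_dotl.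
by rewrite inE => Kp pmax; exists p => // q Kq; apply: pmax; rewrite inE.
Qed.

Lemma support_functionE p u : K p -> (forall q, K q -> dot q u <= dot p u) ->
  support_function K u = dot p u.
Proof.
move=> Kp pmax; apply/eqP; rewrite eq_le; apply/andP; split.
  by apply: ge_sup => [|_ [q Kq <-]]; [exists (dot p u), p|exact: pmax].
apply: ub_le_sup; last by exists p.
by exists (dot p u) => _ [q Kq <-]; exact: pmax.
Qed.

Lemma dot_le_support q u : K q -> dot q u <= support_function K u.
Proof. by have [p Kp pmax] := support_attained u; rewrite (support_functionE Kp)//; exact: pmax. Qed.

(** The normal is the direction from the point of [K] nearest to [q]. *)
Lemma strict_separation q : convex_set K -> ~ K q ->
  exists2 t, - pi <= t <= pi & forall k, K k -> dot k (dir t) < dot q (dir t).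
Proof.
move=> cvxK nKq.
have [|p] := compact_EVT_min K0 cptK (f := fun k : R * R => dot (k - q) (k - q)).
  apply: continuous_subspaceT => k.
  have c1 : {for k, continuous (fun k : R * R => k.1 - q.1)}.
    by apply: cvgB; [exact: cvg_fst|exact: cvg_cst].
  have c2 : {for k, continuous (fun k : R * R => k.2 - q.2)}.
    by apply: cvgB; [exact: cvg_snd|exact: cvg_cst].
  exact: cvgD (cvgM c1 c1) (cvgM c2 c2).
rewrite inE => Kp pmin; pose n := q - p.
have pmin' k : K k -> dot n n <= dot (k - q) (k - q).
  move=> Kk; have := pmin k; rewrite inE => /(_ Kk).
  by apply: le_trans; rewrite /n !dotE/=; lra.
have n_neq0 : 0 < dot n n.
  rewrite lt_def; apply/andP; split; last by rewrite dotE addr_ge0// -expr2 sqr_ge0.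
  apply/eqP; rewrite dotE => n0; apply: nKq.
  have n1 : n.1 = 0 by nra.
  have n2 : n.2 = 0 by nra.
  rewrite (_ : q = p)//; move: n1 n2; rewrite /n; case: (q) (p) => [a b] [c d]/=.
  by move=> ? ?; congr pair; lra.
have obtuse k : K k -> dot (k - p) n <= 0.
  move=> Kk; rewrite leNgt; apply/negP => d0.
  pose w := dot (k - p) (k - p).
  have w0 : 0 <= w by rewrite /w dotE addr_ge0// -expr2 sqr_ge0.
  (* Moving from [p] towards [k] first decreases the distance to [q]. *)
  pose d := dot (k - p) n.
  pose s := Num.min 1 (d / (w + 1)).
  have s0 : 0 < s by rewrite lt_min ltr01 divr_gt0//; lra.
  have s1 : s <= 1 by rewrite ge_min lexx.
  have sw : s * w < 2 * d.
    have : s * (w + 1) <= d by rewrite -ler_pdivlMr ?ge_min ?lexx ?orbT//; lra.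
    by rewrite -/d in d0; nra.
  have := pmin' _ (convex_combination cvxK Kk Kp (ltW s0) s1).
  have -> : dot (s *: k + (1 - s) *: p - q) (s *: k + (1 - s) *: p - q) =
      dot n n - s * (2 * d - s * w).
    by rewrite /d /w /n !dotE/= /GRing.scale/=; ring.
  have : 0 < s * (2 * d - s * w) by rewrite mulr_gt0// subr_gt0.
  by lra.
pose l := Num.sqrt (dot n n).
have l0 : 0 < l by rewrite sqrtr_gt0.
have [|t tpi nt] := @circle_dir (l^-1 *: n).
  rewrite /circle/= dotE/= /GRing.scale/=.
  have -> : l^-1 * n.1 * (l^-1 * n.1) + l^-1 * n.2 * (l^-1 * n.2) =
     dot n n / l ^+ 2 by rewrite dotE; field; rewrite gt_eqF.
  by rewrite sqr_sqrtr ?(ltW n_neq0)// divff// gt_eqF.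
exists t => // k Kk; rewrite -nt.
have dotZr a : dot a (l^-1 *: n) = l^-1 * dot a n.
  by rewrite !dotE/= /GRing.scale/=; ring.
rewrite !dotZr ltr_pM2l ?invr_gt0//.
have := obtuse k Kk; rewrite dotBl.
have : dot q n - dot p n = dot n n by rewrite -dotBl.
by lra.
Qed.

End compact_sets.

End convex_plane.

(** * Support functions of compact convex sets *)

Section convex_sets.
Variable R : realType.
Implicit Types (p q u v z : R * R) (K L : set (R * R)) (s t x : R).

Section compact_sets.
Variable K : set (R * R).
Hypotheses (cptK : compact K) (K0 : K !=set0).

Lemma norm_dot_le p u : `|dot p u| <= (`|p.1| + `|p.2|) * (`|u.1| + `|u.2|).
Proof.
rewrite dotE (le_trans (ler_normD _ _))// !normrM.
have := normr_ge0 p.1; have := normr_ge0 p.2.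
have := normr_ge0 u.1; have := normr_ge0 u.2.
by nra.
Qed.

(** The support function is Lipschitz in the direction, with a constant that
bounds the coordinates of the points of [K]. *)
Lemma continuous_support_function :
  continuous (fun t => support_function K (dir t)).
Proof.
have [|m _ mmax] := compact_EVT_max K0 cptK (f := fun p : R * R => `|p.1| + `|p.2|).
  apply: continuous_subspaceT => p; apply: cvgD; apply: cvg_norm.
    exact: cvg_fst.
  exact: cvg_snd.
pose M := `|m.1| + `|m.2|.
pose g t s := M * (`|cos t - cos s| + `|sin t - sin s|).
have le_g t s : support_function K (dir t) - support_function K (dir s) <= g t s.
  have [p Kp pmax] := support_attained cptK K0 (dir t).
  rewrite (support_functionE Kp pmax).
  have := dot_le_support cptK K0 (dir s) Kp.
  have : dot p (dir t) - dot p (dir s) <= g t s.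
    have -> : dot p (dir t) - dot p (dir s) = dot p (cos t - cos s, sin t - sin s).
      by rewrite !dotE/=; ring.
    apply: le_trans (ler_norm _) _; apply: le_trans (norm_dot_le _ _) _.
    rewrite ler_wpM2r//= ?addr_ge0//; have := mmax p; rewrite inE; exact.
  by lra.
move=> t; apply/cvgrPdist_le => e e0; near=> s.
have gts : g t s <= e.
  near: s; have : g t s @[s --> t] --> M * (`|cos t - cos t| + `|sin t - sin t|).
    apply: cvgMr; apply: cvgD; apply: cvg_norm; apply: cvgB;
      [exact: cvg_cst|exact: continuous_cos|exact: cvg_cst|exact: continuous_sin].
  rewrite !subrr normr0 addr0 mulr0 => /cvgrPdist_le /(_ e e0).
  apply: filterS => s; rewrite sub0r normrN; apply: le_trans; exact: ler_norm.
have gst : g s t = g t s by rewrite /g distrC [X in _ + X]distrC.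
by rewrite ler_norml; have := le_g t s; have := le_g s t; lra.
Unshelve. all: by end_near. Qed.

(** The gap between the support function of [K] and that of the point [p]
attains its minimum; were it positive, a ball around [p] would lie in all the
half-planes that contain [K]. *)
Lemma boundary_supported p : convex_set K -> K p -> ~ K° p ->
  exists t, supports K p t.
Proof.
move=> cvxK Kp nKp; pose gap t := support_function K (dir t) - dot p (dir t).
have cgap : continuous gap.
  move=> t; apply: cvgB; first exact: continuous_support_function.
  apply: cvgD; apply: cvgMr;
    [exact: continuous_cos|exact: continuous_sin].
have [|t tpi tmin] := @EVT_min R gap (- pi) pi _ (continuous_subspaceT cgap).
  by have := pi_gt0 R; lra.
exists t => q Kq; rewrite leNgt; apply/negP => dpq; apply: nKp.
have gap0 : 0 < gap t by rewrite subr_gt0 (lt_le_trans dpq)// dot_le_support.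
rewrite /interior; apply/nbhs_ballP; exists (gap t / 2); first by rewrite /= divr_gt0.
move=> r [/= r1 r2]; apply: contrapT => nKr.
have [s spi sep] := strict_separation cptK K0 cvxK nKr.
have [k Kk kmax] := support_attained cptK K0 (dir s).
have := sep k Kk; have := tmin s; rewrite in_itv/= => /(_ spi).
rewrite [X in _ <= X]/gap (support_functionE Kk kmax).
have : dot r (dir s) - dot p (dir s) < gap t.
  rewrite -dotBl (le_lt_trans (ler_norm _))//.
  have -> : dot (r - p) (dir s) = (r.1 - p.1) * cos s + (r.2 - p.2) * sin s by [].
  rewrite (le_lt_trans (ler_normD _ _))// !normrM.
  have := cos_max s; have := sin_max s.
  move: r1 r2; rewrite /ball/= ![`|p.1 - _|]distrC ![`|p.2 - _|]distrC.
  have := normr_ge0 (r.1 - p.1); have := normr_ge0 (r.2 - p.2).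
  have := normr_ge0 (cos s); have := normr_ge0 (sin s).
  by nra.
by lra.
Qed.

End compact_sets.

(** A point of [K] outside the dilate of [L] would be strictly separated from it
in some direction, where the support functions would then compare the wrong
way. *)
Lemma support_function_sub K L c : compact K -> K !=set0 ->
    compact L -> L !=set0 -> convex_set L -> 0 < c ->
    (forall t, support_function K (dir t) <= c * support_function L (dir t)) ->
  K `<=` [set c *: p | p in L].
Proof.
move=> cptK K0 cptL L0 cvxL c0 KL p Kp; exists (c^-1 *: p); last first.
  by rewrite scalerA divff ?scale1r// gt_eqF.
apply: contrapT => nLp; have [t _ sep] := strict_separation cptL L0 cvxL nLp.
have [q Lq qmax] := support_attained cptL L0 (dir t).
have := sep q Lq; rewrite dotZl -(support_functionE Lq qmax) ltr_pdivlMl//.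
by rewrite ltNge => /negP; apply; apply: le_trans (KL t); exact: dot_le_support.
Qed.

Lemma support_function_dilate K c u : compact K -> K !=set0 -> 0 < c ->
  support_function [set c *: p | p in K] u = c * support_function K u.
Proof.
move=> cptK K0 c0; have [p Kp pmax] := support_attained cptK K0 u.
rewrite (support_functionE Kp pmax) -dotZl; apply: support_functionE.
  by exists p.
by move=> _ [q Kq <-]; rewrite !dotZl ler_pM2l//; exact: pmax.
Qed.

End convex_sets.

(** * The support function near a boundary point of positive curvature *)

Section one_variable.
Variable R : realType.
Implicit Types (f g df dg : R -> R) (s t x : R).

Lemma derivative_at_max g dg t : (forall s, is_derive s 1 g (dg s)) ->
  (forall s, g s <= g t) -> dg t = 0.
Proof.
move=> gd gmax; apply: (is_derive_unique (gd t)).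
apply: (@derive1_at_max _ g (t - 1) (t + 1)) => //; first by lra.
by rewrite in_itv/=; lra.
Qed.

(** If [l > 0], then [dg] is positive just to the right of its zero [t], and [g]
increases there. *)
Lemma second_derivative_at_max g dg t l : (forall s, is_derive s 1 g (dg s)) ->
    is_derive t 1 dg l -> (forall s, g s <= g t) ->
  dg t = 0 /\ l <= 0.
Proof.
move=> gd dgd gmax.
have dgt0 := derivative_at_max gd gmax.
split=> //; rewrite leNgt; apply/negP => l0.
have /is_derive1_caratheodory[h [hE ch ht]] := dgd.
have /nbhs_ballP[e /= e0 hpos] : \forall s \near t, 0 < h s.
  by apply: (cvgr_gt _ ch); rewrite ht.
pose s := t + e / 2; have ts : t < s by rewrite ltrDl divr_gt0.
have [|c cts gE] := @MVT R g dg t s ts (fun x _ => gd x).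
  by apply: continuous_subspaceT => x; exact: is_derive_continuous (gd x).
move: cts; rewrite in_itv/= => /andP[tc cs].
have : 0 < dg c.
  have := hE c; rewrite dgt0 subr0 => ->; rewrite mulr_gt0 ?subr_gt0//.
  by apply: hpos; rewrite /ball/= ltr_norml; move: cs; rewrite /s; lra.
move=> dgc; have := gmax s; rewrite -subr_le0 gE leNgt => /negP; apply.
by rewrite mulr_gt0// subr_gt0.
Qed.

(** Near [t] the derivative has no zero, so by the mean value theorem [f] is
injective on a ball around [t]; [g] picks the preimage in this ball. *)
Lemma local_inverse f df t : (\forall s \near t, is_derive (s : R) 1 f (df s)) ->
    {for t, continuous df} -> df t != 0 ->
  exists g, [/\ g (f t) = t, is_derive (f t) 1 g (df t)^-1
    & \forall x \near f t, f (g x) = x].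
Proof.
move=> fd cdf dft0.
have dfne0 : \forall s \near t, df s != 0 by exact: (cvgr_neq0 _ cdf).
have /nbhs_ballP[e /= e0 He] : \forall s \near t, is_derive (s : R) 1 f (df s) /\ df s != 0.
  by near=> s; split; near: s.
have inj a b : ball t e a -> ball t e b -> a <= b -> f a = f b -> a = b.
  move=> ta tb ab fab.
  have tc c : a <= c <= b -> ball t e c.
    by move: ta tb; rewrite /ball/= !ltr_distlC; lra.
  have [x axb|c /tc/He[_ dfc]] := @mean_value R f df a b ab.
    by have [] := He x (tc x axb).
  rewrite fab subrr => /esym/eqP; rewrite mulf_eq0 (negPf dfc)/= subr_eq0.
  by move/eqP.
pose g y := xget t [set s | ball t e s /\ f s = y].
have gK s : ball t e s -> g (f s) = s.
  move=> ts; rewrite /g; case: xgetP => [u _ [tu fu]|/(_ s)]; last by case.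
  by have [us|/ltW su] := leP u s; [exact: inj|apply/esym; exact: inj].
have ngK : {near t, cancel f g}.
  by apply/nbhs_ballP; exists e.
have nf : {near t, continuous f}.
  by apply: filterS fd => s; exact: is_derive_continuous.
exists g; split.
- exact/gK/ballxx.
- by apply: is_derive_inverse => //; exact: nbhs_singleton fd.
- exact: near_continuous_can_sym.
Unshelve. all: by end_near. Qed.

End one_variable.

Section local_gauss.
Variable R : realType.
Variable K : set (R * R).
Hypothesis cK : convex_body K.

Lemma convex_body_compact : compact K. Proof. by case: cK. Qed.

Lemma convex_body_nonempty : K !=set0.
Proof. by case: cK => _ _ [p Kp]; exists p; exact: interior_subset. Qed.

Lemma boundary_sub : boundary K `<=` K.
Proof.
have cl : closed K by apply: compact_closed; [exact: norm_hausdorff|case: cK].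
by move=> p [clp _]; apply: cl.
Qed.

Lemma supports_boundary p (th : R) : K p -> supports K p th -> boundary K p.
Proof.
move=> Kp sp; split; first exact: subset_closure.
by move=> /(interior_not_support th)[q /sp]; rewrite leNgt => /negP.
Qed.

Lemma C2P (f : R -> R) : C2 f -> exists df ddf : R -> R,
  [/\ derive1 f = df, derive1n 2 f = ddf, forall t : R, is_derive t 1 f (df t),
      forall t : R, is_derive t 1 df (ddf t) & continuous ddf].
Proof.
move=> [df ddf cddf]; exists (derive1 f), (derive1n 2 f).
split; [by []|by []| | |exact: cddf] => t.
  by rewrite derive1E; exact/derivableP/df.
by rewrite derive1nS derive1n1 derive1E; exact/derivableP/ddf.
Qed.

Variables (x y : R -> R) (T : R).
Hypothesis curve : C2_closed_curve (boundary K) x y T.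

Lemma curve_boundary t : boundary K (x t, y t).
Proof. by case: curve => _ _ _ _ <-; exists t. Qed.

(** The function [s |-> dot (x s, y s) (dir th)] is maximal at [t]. *)
Lemma curve_supported t th : supports K (x t, y t) th ->
  cos th * derive1 x t + sin th * derive1 y t = 0 /\
  cos th * derive1n 2 x t + sin th * derive1n 2 y t <= 0.
Proof.
move=> st; have [[/C2P[dx [ddx [-> -> xd xdd _]]]]] := curve.
move=> /C2P[dy [ddy [-> -> yd ydd _]]] _ _ _ _.
pose g s := cos th * x s + sin th * y s.
pose dg s := cos th * dx s + sin th * dy s.
have gd (s : R) : is_derive s 1 g (dg s) by apply: is_derive_add; exact: is_derive_scale.
have dgd : is_derive t 1 dg (cos th * ddx t + sin th * ddy t).
  by apply: is_derive_add; exact: is_derive_scale.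
have gmax s : g s <= g t.
  have := st _ (boundary_sub (curve_boundary s)).
  by rewrite !dotE/= /g ![cos th * _]mulrC ![sin th * _]mulrC.
exact: (second_derivative_at_max gd dgd gmax).
Qed.

(** In the frame formed by [dir th0] and its rotation by a quarter turn, the
velocity of the curve has coordinates [(a, b)], and [dir (th0 + phi)] is normal
to it when [tan phi = - a / b]. This defines an angle [f t], whose derivative at
[t0] is [b] times the curvature; its local inverse is [tau]. The boundary point
of parameter [tau th] has some supporting line, which must be tangent to the
curve; a fixed interior point tells [dir th] from [- dir th]. *)
Lemma local_gauss t0 th0 : supports K (x t0, y t0) th0 ->
    0 < curve_curvature x y t0 ->
  exists tau : R -> R, [/\ tau th0 = t0, {for th0, continuous tau},
    \forall th \near th0, supports K (x (tau th), y (tau th)) th,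
    is_derive th0 1 (fun th => x (tau th)) (- sin th0 / curve_curvature x y t0)
  & is_derive th0 1 (fun th => y (tau th)) (cos th0 / curve_curvature x y t0)].
Proof.
move=> st0 k0; have [[/C2P[dx [ddx [dxE ddxE xd xdd cxdd]]]]] := curve.
move=> /C2P[dy [ddy [dyE ddyE yd ydd cydd]]] reg _ _ _.
have supported := curve_supported; rewrite dxE dyE ddxE ddyE in supported.
move: reg; rewrite dxE dyE => reg.
have kdef : curve_curvature x y t0 = `|dx t0 * ddy t0 - dy t0 * ddx t0|
    / Num.sqrt (dx t0 ^+ 2 + dy t0 ^+ 2) ^+ 3.
  by rewrite /curve_curvature dxE dyE ddxE ddyE.
move: k0 kdef; move: (curve_curvature x y t0) => k k0 kdef.
pose c := cos th0; pose s := sin th0.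
have cs1 : c ^+ 2 + s ^+ 2 = 1 by exact: cos2Dsin2.
pose a t := c * dx t + s * dy t.
pose b t := c * dy t - s * dx t.
pose da t := c * ddx t + s * ddy t.
pose db t := c * ddy t - s * ddx t.
have ad (t : R) : is_derive t 1 a (da t).
  by apply: is_derive_add; exact: is_derive_scale.
have bd (t : R) : is_derive t 1 b (db t).
  by apply: is_derive_sub; exact: is_derive_scale.
have [a0 da_le0] : a t0 = 0 /\ da t0 <= 0.
  exact: supported st0.
have speedE t : dx t ^+ 2 + dy t ^+ 2 = a t ^+ 2 + b t ^+ 2.
  have -> : a t ^+ 2 + b t ^+ 2 =
    (c ^+ 2 + s ^+ 2) * (dx t ^+ 2 + dy t ^+ 2) by rewrite /a /b; ring.
  by rewrite cs1 mul1r.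
have detE t : dx t * ddy t - dy t * ddx t =
    a t * db t - b t * da t.
  have -> : a t * db t - b t * da t = (c ^+ 2 + s ^+ 2) *
    (dx t * ddy t - dy t * ddx t).
    by rewrite /a /b /da /db; ring.
  by rewrite cs1 mul1r.
have b0 : b t0 != 0.
  apply/eqP => b0; have := reg t0; move=> /eqP; apply.
  have := speedE t0; rewrite a0 b0 expr0n/= addr0 => /eqP.
  rewrite paddr_eq0 ?sqr_ge0// !sqrf_eq0 => /andP[/eqP -> /eqP ->].
  by [].
have kE : k = - da t0 / b t0 ^+ 2.
  rewrite kdef speedE detE a0 mul0r sub0r normrN normrM.
  rewrite expr0n/= add0r sqrtr_sqr -(ler0_norm da_le0) -(real_normK (num_real (b t0))).
  by field; rewrite normr_eq0.
have da0 : da t0 < 0.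
  rewrite lt_neqAle da_le0 andbT; apply/eqP => da0.
  by rewrite kE da0 oppr0 mul0r ltxx in k0.
pose f t := th0 + atan (- a t / b t).
pose df t := (a t * db t - da t * b t) / (a t ^+ 2 + b t ^+ 2).
have cont_ab (g dg : R -> R) : (forall t : R, is_derive t 1 g (dg t)) -> continuous g.
  by move=> gd t; exact: is_derive_continuous (gd t).
have ca := cont_ab _ _ ad; have cb := cont_ab _ _ bd.
have nb0 : \forall t \near t0, b t != 0 by exact: (cvgr_neq0 _ (cb t0)).
have fd : \forall t \near t0, is_derive (t : R) 1 f (df t).
  near=> t; have bt0 : b t != 0 by near: t.
  have := is_derive_comp (is_derive_div bt0 (is_derive_opp (ad t)) (bd t))
    (is_derive1_atan _).
  move/(is_derive_add (is_derive_cst th0 t 1)) => fd.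
  apply: (is_derive_eq fd); rewrite add0r /df.
  have ab0 : 0 < a t ^+ 2 + b t ^+ 2.
    by rewrite ltr_wpDl ?sqr_ge0// lt_def sqr_ge0 sqrf_eq0 bt0.
  by field; rewrite (gt_eqF ab0) bt0.
have cda : continuous da.
  by move=> t; apply: cvgD; apply: cvgMr; [exact: cxdd|exact: cydd].
have cdb : continuous db.
  by move=> t; apply: cvgB; apply: cvgMr; [exact: cydd|exact: cxdd].
have ab0 : a t0 ^+ 2 + b t0 ^+ 2 != 0.
  by rewrite a0 expr0n/= add0r sqrf_eq0.
have cdf : {for t0, continuous df}.
  apply: cvgM.
    by apply: cvgB; apply: cvgM; [exact: ca|exact: cdb|exact: cda|exact: cb].
  by apply: cvgV => //; apply: cvgD; apply: cvgM; do ?[exact: ca|exact: cb].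
have dfE : df t0 = - da t0 / b t0.
  by rewrite /df a0; field.
have df0 : df t0 != 0.
  by rewrite dfE mulf_neq0 ?invr_eq0// oppr_eq0 lt_eqF.
have ft0 : f t0 = th0 by rewrite /f a0 oppr0 mul0r atan0 addr0.
have [tau] := local_inverse fd cdf df0; rewrite ft0 => -[tau0 taud nearf].
have ctau : {for th0, continuous tau} by exact: is_derive_continuous taud.
have dxt0 : dx t0 = - s * b t0.
  have -> : dx t0 = (c ^+ 2 + s ^+ 2) * dx t0 by rewrite cs1 mul1r.
  have -> : (c ^+ 2 + s ^+ 2) * dx t0 = c * a t0 - s * b t0.
    by rewrite /a /b; ring.
  by rewrite a0; ring.
have dyt0 : dy t0 = c * b t0.
  have -> : dy t0 = (c ^+ 2 + s ^+ 2) * dy t0 by rewrite cs1 mul1r.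
  have -> : (c ^+ 2 + s ^+ 2) * dy t0 = s * a t0 + c * b t0.
    by rewrite /a /b; ring.
  by rewrite a0; ring.
have xtaud : is_derive th0 1 (fun th => x (tau th)) (- s / k).
  have xd' : is_derive (tau th0) 1 x (- s * b t0) by rewrite tau0 -dxt0.
  apply: (is_derive_eq (is_derive_comp taud xd')); rewrite kE dfE; field.
  by rewrite b0 lt_eqF.
have ytaud : is_derive th0 1 (fun th => y (tau th)) (c / k).
  have yd' : is_derive (tau th0) 1 y (c * b t0) by rewrite tau0 -dyt0.
  apply: (is_derive_eq (is_derive_comp taud yd')); rewrite kE dfE; field.
  by rewrite b0 lt_eqF.
exists tau; split=> //.
have [_ _ [z Kz]] := cK.
have z_lt : \forall th \near th0,
    dot z (dir th) < dot (x (tau th), y (tau th)) (dir th).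
  pose gap (th : R) := dot (x (tau th), y (tau th)) (dir th) - dot z (dir th).
  have cgap : {for th0, continuous gap}.
    have cx := is_derive_continuous xtaud; have cy := is_derive_continuous ytaud.
    have cc : {for th0, continuous cos} by exact: continuous_cos.
    have cs : {for th0, continuous sin} by exact: continuous_sin.
    apply: cvgB; apply: cvgD; apply: cvgM => //; exact: cvg_cst.
  have gap0 : 0 < gap th0.
    rewrite subr_gt0 tau0; have [q Kq zq] := interior_not_support th0 Kz.
    exact: lt_le_trans zq (st0 _ Kq).
  have gapn : \forall th \near th0, 0 < gap th by exact: (cvgr_gt _ cgap).
  by apply: filterS gapn => th; rewrite subr_gt0.
have nb_tau : \forall th \near th0, b (tau th) != 0.
  have cbt : (b \o tau) th @[th --> th0] --> b (tau th0).
    exact: (continuous_comp ctau (cb (tau th0))).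
  by rewrite tau0 in cbt; exact: (cvgr_neq0 _ cbt).
near=> th.
have ft : f (tau th) = th by near: th.
have bt0 : b (tau th) != 0 by near: th.
have zt : dot z (dir th) < dot (x (tau th), y (tau th)) (dir th) by near: th.
move: (tau th) ft bt0 zt => t ft bt0 zt.
have ndir_th : cos th * dx t + sin th * dy t = 0.
  pose phi := atan (- a t / b t).
  have cphi : cos phi != 0.
    by rewrite gt_eqF// cos_gt0_pihalf// atan_gtNpi2 atan_ltpi2.
  have sphi : b t * sin phi = - a t * cos phi.
    have : tan phi = - a t / b t by rewrite atanK.
    by rewrite /tan => /(canRL (mulfVK cphi)) ->; field.
  rewrite -ft /f -/phi cosD sinD -/c -/s.
  have -> : (c * cos phi - s * sin phi) * dx t +
      (s * cos phi + c * sin phi) * dy t =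
      a t * cos phi + b t * sin phi by rewrite /a /b; ring.
  by rewrite sphi; ring.
have cvxK : convex_set K by case: cK.
have [th' st'] := boundary_supported convex_body_compact convex_body_nonempty cvxK
    (boundary_sub (curve_boundary t)) (proj2 (curve_boundary t)).
have [ndir_th' _] := supported _ _ st'.
have v0 : dx t ^+ 2 + dy t ^+ 2 != 0.
  by rewrite speedE gt_eqF// ltr_wpDl ?sqr_ge0// lt_def sqr_ge0 sqrf_eq0 bt0.
have parallel : cos th * sin th' = sin th * cos th'.
  have : (dx t ^+ 2 + dy t ^+ 2) *
      (cos th * sin th' - sin th * cos th') = 0.
    transitivity ((cos th * dx t + sin th * dy t) *
        (dx t * sin th' - dy t * cos th') +
      (cos th' * dx t + sin th' * dy t) *
        (dy t * cos th - dx t * sin th)); first by ring.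
    by rewrite ndir_th ndir_th' !mul0r addr0.
  by move/eqP; rewrite mulf_eq0 (negPf v0)/= subr_eq0 => /eqP.
pose l := cos th * cos th' + sin th * sin th'.
have th'E : dir th' = l *: dir th.
  have := cos2Dsin2 th => E; rewrite /dir /l; congr pair; rewrite /GRing.scale/=.
    transitivity ((cos th ^+ 2 + sin th ^+ 2) * cos th'); first by rewrite E mul1r.
    transitivity (cos th * cos th' * cos th + sin th * (sin th * cos th')).
      by ring.
    by rewrite -parallel; ring.
  transitivity ((cos th ^+ 2 + sin th ^+ 2) * sin th'); first by rewrite E mul1r.
  transitivity (sin th * sin th' * sin th + cos th * (cos th * sin th')).
    by ring.
  by rewrite parallel; ring.
have dotl p : dot p (dir th') = l * dot p (dir th).
  by rewrite th'E !dotE/= /GRing.scale/=; ring.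
have l_gt0 : 0 < l.
  have := st' _ (interior_subset Kz); rewrite !dotl.
  rewrite leNgt => /negP H; rewrite ltNge; apply/negP => l_le0.
  have l_neq0 : l != 0.
    have := dot_dir_norm th'; rewrite dotl; apply: contra_eq_neq => ->.
    by rewrite mul0r eq_sym oner_neq0.
  apply: H; rewrite ltr_nM2l// lt_neqAle l_neq0; exact: l_le0.
by move=> q /st'; rewrite !dotl ler_pM2l.
Unshelve. all: by end_near. Qed.

End local_gauss.

(** * The support function of a body with positive curvature *)

Section gauss_data.
Variable R : realType.
Implicit Types (p q : R * R) (t s th : R) (K : set (R * R)).

Definition gauss_point K th := inverse_gauss_map K (dir th).
Definition gauss_x K th := (gauss_point K th).1.
Definition gauss_y K th := (gauss_point K th).2.
Definition body_support K th := support_function K (dir th).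
(** The tangential coordinate of the Gauss point; see [body_support_derive]. *)
Definition body_support' K th := - sin th * gauss_x K th + cos th * gauss_y K th.
Definition curvature_radius K th := (curvature K (dir th))^-1.

Section one_body.
Variable K : set (R * R).
Hypotheses (cK : convex_body K) (C2K : has_C2_boundary_of_positive_curvature K).

Local Notation P := (gauss_point K).
Local Notation X := (gauss_x K).
Local Notation Y := (gauss_y K).
Local Notation h := (body_support K).
Local Notation dh := (body_support' K).
Local Notation r := (curvature_radius K).

Let cptK := convex_body_compact cK.
Let K0 := convex_body_nonempty cK.

Lemma gauss_pointP th : boundary K (P th) /\ supports K (P th) th.
Proof.
have [|bP [_ sP]] := @getPex _ [set p | boundary K p /\ is_outer_unit_normal K p (dir th)].
  have [p Kp pmax] := support_attained cptK K0 (dir th).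
  exists p; split; first exact: supports_boundary pmax.
  by split=> //; exact: dot_dir_norm.
by split.
Qed.

Lemma gauss_xy th : P th = (X th, Y th).
Proof. by rewrite /gauss_x /gauss_y -surjective_pairing. Qed.

Lemma body_supportE th : h th = cos th * X th + sin th * Y th.
Proof.
have [bP sP] := gauss_pointP th.
rewrite /body_support (support_functionE (boundary_sub cK bP) sP) gauss_xy dotE/=.
by rewrite ![_ * cos th]mulrC ![_ * sin th]mulrC.
Qed.

Lemma body_support_max p th : K p -> supports K p th -> h th = dot p (dir th).
Proof. exact: support_functionE. Qed.

(** Each boundary point comes with its own parametrization, the one from which
[boundary_curvature] takes its value there. *)
Lemma curve_through p : boundary K p -> exists x y T t,
  [/\ C2_closed_curve (boundary K) x y T, (x t, y t) = p,
      boundary_curvature K p = curve_curvature x y t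
    & 0 < curve_curvature x y t].
Proof.
move=> bp; have [[x [y [T curve]]] Kpos] := C2K.
have [|x' [y' [T' [t' [curve' pE kE]]]]] := @getPex _ [set k | exists x y T t,
    [/\ C2_closed_curve (boundary K) x y T, (x t, y t) = p & k = curve_curvature x y t]].
  have [_ _ _ _ rng] := curve; have [t _ pE] : range (fun t => (x t, y t)) p by rewrite rng.
  by exists (curve_curvature x y t), x, y, T, t; split.
by exists x', y', T', t'; split=> //; rewrite -kE; exact: Kpos.
Qed.

(** By [local_gauss] the support function is, near [th], the value of
[dot _ (dir s)] at the moving point [(x (tau s), y (tau s))]. The motion of this
point is orthogonal to [dir th], so only the motion of [dir s] contributes. *)
Lemma body_support_derive th : is_derive th 1 h (dh th).
Proof.
have [bP sP] := gauss_pointP th.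
have [x [y [T [t [curve pE _ k0]]]]] := curve_through bP.
rewrite -pE in sP.
have [tau [tau0 _ near_sup xd yd]] := local_gauss cK curve sP k0.
have := is_derive_add (is_derive_mul (is_derive_cos th) xd)
  (is_derive_mul (is_derive_sin th) yd).
move=> hd; have {}hd := near_eq_is_derive _ hd.
apply: is_derive_eq (hd _ _) _.
  apply: filterS near_sup => s sup.
  rewrite (body_support_max (boundary_sub cK (curve_boundary curve (tau s))) sup).
  by rewrite dotE/=; ring.
move: pE; rewrite tau0 gauss_xy => -[-> ->]; rewrite /body_support'.
by ring.
Qed.

(** The support function dominates [dot p (dir th)] with equality at [th], so
its derivative at [th] determines the tangential coordinate of [p]. *)
Lemma gauss_point_unique p th : K p -> supports K p th -> p = P th.
Proof.
move=> Kp sp; have hth := body_support_max Kp sp.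
pose g s := cos s * p.1 + sin s * p.2 - h s.
have gd s : is_derive s 1 g (- sin s * p.1 + cos s * p.2 - dh s).
  apply: is_derive_sub; last exact: body_support_derive.
  have := is_derive_add (is_derive_scale p.1 (is_derive_cos s))
    (is_derive_scale p.2 (is_derive_sin s)).
  rewrite (_ : (fun _ => _) = (fun s => cos s * p.1 + sin s * p.2)); last first.
    by apply/funext => ?; ring.
  by move=> gd; apply: (is_derive_eq gd); ring.
have dotcs s : dot p (dir s) = cos s * p.1 + sin s * p.2 by rewrite dotE/=; ring.
have gmax s : g s <= g th.
  have gth : g th = 0 by rewrite /g hth dotcs subrr.
  by rewrite gth subr_le0 -dotcs; exact: dot_le_support.
have := derivative_at_max gd gmax; rewrite /body_support'.
have := hth; rewrite body_supportE dotcs gauss_xy; have := cos2Dsin2 th.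
rewrite [p]surjective_pairing/=.
move: (cos th) (sin th) (X th) (Y th) p.1 p.2 => c s u v a b cs E1 E2.
have F1 : c * (a - u) + s * (b - v) = 0 by lra.
have F2 : c * (b - v) - s * (a - u) = 0 by lra.
have a_u : a - u = 0.
  transitivity ((c ^+ 2 + s ^+ 2) * (a - u)); first by rewrite cs mul1r.
  transitivity (c * (c * (a - u) + s * (b - v)) - s * (c * (b - v) - s * (a - u))).
    by ring.
  by rewrite F1 F2; ring.
have b_v : b - v = 0.
  transitivity ((c ^+ 2 + s ^+ 2) * (b - v)); first by rewrite cs mul1r.
  transitivity (s * (c * (a - u) + s * (b - v)) + c * (c * (b - v) - s * (a - u))).
    by ring.
  by rewrite F1 F2; ring.
by congr pair; lra.
Qed.

(** By uniqueness of the point with a given normal, the Gauss point follows any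
boundary curve that passes through it with positive curvature. *)
Lemma gauss_curve_derive x y T t th : C2_closed_curve (boundary K) x y T ->
    (x t, y t) = P th -> 0 < curve_curvature x y t ->
  exists tau : R -> R, [/\ tau th = t, {for th, continuous tau},
    \forall s \near th, (x (tau s), y (tau s)) = P s,
    is_derive th 1 X (- sin th / curve_curvature x y t)
  & is_derive th 1 Y (cos th / curve_curvature x y t)].
Proof.
move=> curve pE k0; have [_ sP] := gauss_pointP th; rewrite -pE in sP.
have [tau [tau0 ctau near_sup xd yd]] := local_gauss cK curve sP k0.
have nearP : \forall s \near th, (x (tau s), y (tau s)) = P s.
  apply: filterS near_sup => s; apply: gauss_point_unique.
  exact: boundary_sub (curve_boundary curve (tau s)).
exists tau; split=> //.
  apply: near_eq_is_derive xd; apply: filterS nearP => s.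
  by rewrite gauss_xy => -[].
apply: near_eq_is_derive yd; apply: filterS nearP => s.
by rewrite gauss_xy => -[].
Qed.

Lemma gauss_derive th : [/\ 0 < r th, is_derive th 1 X (- sin th * r th)
  & is_derive th 1 Y (cos th * r th)].
Proof.
have [bP _] := gauss_pointP th.
have [x [y [T [t [curve pE kE k0]]]]] := curve_through bP.
have [tau [_ _ _ Xd Yd]] := gauss_curve_derive curve pE k0.
by rewrite /curvature_radius /curvature -/(P th) kE invr_gt0.
Qed.

(** The derivative of the Gauss point at [th] does not refer to a parametrization,
so the curvature is the same for all of them. *)
Lemma curvature_radiusE x y T t th : C2_closed_curve (boundary K) x y T ->
    (x t, y t) = P th -> 0 < curve_curvature x y t ->
  r th = (curve_curvature x y t)^-1.
Proof.
move=> curve pE k0; have [_ [_ _ _ Xd Yd]] := gauss_curve_derive curve pE k0.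
have [_ Xd' Yd'] := gauss_derive th.
have E1 := is_derive_unique Xd Xd'; have E2 := is_derive_unique Yd Yd'.
have cs := cos2Dsin2 th.
transitivity ((cos th ^+ 2 + sin th ^+ 2) * r th); first by rewrite cs mul1r.
transitivity (cos th * (cos th * r th) - sin th * (- sin th * r th)); first by ring.
by rewrite -E1 -E2; rewrite -[RHS]mul1r -cs; ring.
Qed.

Lemma continuous_curve_curvature x y T : C2_closed_curve (boundary K) x y T ->
  continuous (curve_curvature x y).
Proof.
move=> [[/C2P[dx [ddx [dxE ddxE xd xdd cxdd]]] /C2P[dy [ddy [dyE ddyE yd ydd cydd]]]]].
rewrite dxE dyE => reg _ _ _.
rewrite (_ : curve_curvature x y = fun t => `|dx t * ddy t - dy t * ddx t|
    / Num.sqrt (dx t ^+ 2 + dy t ^+ 2) ^+ 3); last first.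
  by apply/funext => t; rewrite /curve_curvature dxE dyE ddxE ddyE.
have cdx := is_derive_continuousT xdd; have cdy := is_derive_continuousT ydd.
move=> t; apply: cvgM.
  apply: cvg_norm; apply: cvgB; apply: cvgM;
    [exact: cdx|exact: cydd|exact: cdy|exact: cxdd].
have speed0 : 0 < dx t ^+ 2 + dy t ^+ 2.
  rewrite lt_def addr_ge0 ?sqr_ge0// andbT; have := reg t.
  apply: contra; rewrite paddr_eq0 ?sqr_ge0// !sqrf_eq0 => /andP[/eqP dx0 /eqP dy0].
  by apply/eqP; rewrite dx0 dy0.
apply: cvgV; first by rewrite gt_eqF// exprn_gt0// sqrtr_gt0.
have cs : Num.sqrt (dx s ^+ 2 + dy s ^+ 2) @[s --> t] --> Num.sqrt (dx t ^+ 2 + dy t ^+ 2).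
  apply: (@continuous_comp _ _ _ (fun s => dx s ^+ 2 + dy s ^+ 2) Num.sqrt t);
    last exact: sqrt_continuous.
  by apply: cvgD; apply: cvgM; do ?[exact: cdx|exact: cdy].
exact: (cvgM cs (cvgM cs cs)).
Qed.

(** Near [th] the radius of curvature can be read off the single curve through
the Gauss point at [th], whose curvature is continuous in the parameter. *)
Lemma continuous_curvature_radius : continuous r.
Proof.
move=> th; have [bP _] := gauss_pointP th.
have [x [y [T [t [curve pE kE k0]]]]] := curve_through bP.
have [tau [tau0 ctau nearP _ _]] := gauss_curve_derive curve pE k0.
have ck : (fun s => curve_curvature x y (tau s)) s @[s --> th] --> curve_curvature x y (tau th).
  apply: (@continuous_comp _ _ _ tau (curve_curvature x y) th ctau).
  exact: (continuous_curve_curvature curve).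
have nk : \forall s \near th, 0 < curve_curvature x y (tau s).
  by rewrite tau0 in ck; exact: (cvgr_gt _ ck).
have nr : \forall s \near th, (curve_curvature x y (tau s))^-1 = r s.
  near=> s; apply/esym; apply: (curvature_radiusE curve); near: s; last exact: nk.
  exact: nearP.
rewrite /continuous_at (curvature_radiusE curve pE k0) -tau0.
apply: cvg_trans (near_eq_cvg nr) _.
by apply: cvgV; [rewrite tau0 gt_eqF|exact: ck].
Unshelve. all: by end_near. Qed.

Lemma body_support'_derive th : is_derive th 1 dh (r th - h th).
Proof.
have [_ Xd Yd] := gauss_derive th.
have := is_derive_add
  (is_derive_mul (is_derive_opp (is_derive_sin th)) Xd)
  (is_derive_mul (is_derive_cos th) Yd).
move=> dhd; apply: (is_derive_eq dhd); rewrite body_supportE.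
have := cos2Dsin2 th => cs.
transitivity ((cos th ^+ 2 + sin th ^+ 2) * r th - (cos th * X th + sin th * Y th)).
  by ring.
by rewrite cs mul1r.
Qed.

Lemma gauss_xE th : X th = cos th * h th - sin th * dh th.
Proof.
rewrite body_supportE /body_support'; rewrite -[LHS]mul1r -(cos2Dsin2 th); ring.
Qed.

Lemma gauss_yE th : Y th = sin th * h th + cos th * dh th.
Proof.
rewrite body_supportE /body_support'; rewrite -[LHS]mul1r -(cos2Dsin2 th); ring.
Qed.

Hypothesis symK : origin_symmetric K.

Lemma symP p : K p -> K (- p).
Proof. by move=> Kp; rewrite symK; exists p. Qed.

(** An interior point and its antipode give two bounds whose sum is positive. *)
Lemma body_support_gt0 th : 0 < h th.
Proof.
have [_ _ [z Kz]] := cK; have [q Kq zq] := interior_not_support th Kz.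
have := dot_le_support cptK K0 (dir th) Kq.
have := dot_le_support cptK K0 (dir th) (symP (interior_subset Kz)).
by rewrite dotNl -/(h th); lra.
Qed.

Lemma body_support_periodic : periodic h pi.
Proof.
move=> th; have [bP sP] := gauss_pointP th; have KP := boundary_sub cK bP.
rewrite (body_support_max KP sP).
have dirE p : dot p (dir (th + pi)) = - dot p (dir th).
  by rewrite !dotE/= cosDpi sinDpi; ring.
rewrite -[RHS]opprK -dotNl -dirE; apply: body_support_max; first exact: symP.
by move=> q Kq; rewrite !dirE dotNl opprK -dotNl; apply: sP; exact: symP.
Qed.

Lemma body_smooth_support : smooth_support h dh r.
Proof.
split; [exact: body_support_derive|exact: body_support'_derive|
  exact: continuous_curvature_radius| |exact: body_support_periodic].
by move=> th; split; [exact: body_support_gt0|have [] := gauss_derive th].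
Qed.

End one_body.
End gauss_data.

(** * The area in terms of the support function *)

Section area.
Variable R : realType.
Variable K : set (R * R).
Hypotheses (cK : convex_body K) (C2K : has_C2_boundary_of_positive_curvature K).
Hypothesis symK : origin_symmetric K.
Implicit Types (t th x y : R).

Local Notation P := (gauss_point K).
Local Notation X := (gauss_x K).
Local Notation Y := (gauss_y K).
Local Notation h := (body_support K).
Local Notation r := (curvature_radius K).
Local Notation mu := (@lebesgue_measure R).
Local Notation I := (@period_integral R).

Let smooth := body_smooth_support cK C2K symK.

Lemma gauss_x_derive th : is_derive th 1 X (- sin th * r th).
Proof. by have [] := gauss_derive cK C2K th. Qed.

Lemma gauss_y_derive th : is_derive th 1 Y (cos th * r th).
Proof. by have [] := gauss_derive cK C2K th. Qed.

Let cX : continuous X := is_derive_continuousT gauss_x_derive.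
Let cY : continuous Y := is_derive_continuousT gauss_y_derive.
Let cr : continuous r := continuous_curvature_radius cK C2K.

Lemma gauss_antipodal th : X (th + pi) = - X th /\ Y (th + pi) = - Y th.
Proof.
have [_ _ dhp _ _] := smooth_supportP smooth; have [_ _ _ _ hp] := smooth.
by rewrite !(gauss_xE cK) !(gauss_yE cK) hp dhp cosDpi sinDpi; split; ring.
Qed.

(** The derivative [- sin th * r th] is negative in the open interval. *)
Lemma gauss_x_decreasing : {in `[0, pi]%R &, {homo X : a b /~ a < b}}.
Proof.
move=> b a bI aI ab; move: bI aI; rewrite !in_itv/= => /andP[b0 bpi] /andP[a0 api].
have [|c] := @MVT R X (fun th => - sin th * r th) a b ab
    (fun th _ => gauss_x_derive th).
  exact: continuous_subspaceT.
rewrite in_itv/= => /andP[ac cb] E.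
have s0 : 0 < sin c by apply: sin_gt0_pi; rewrite (le_lt_trans a0)//= (lt_le_trans cb).
have [r0 _ _] := gauss_derive cK C2K c.
rewrite -subr_lt0 E pmulr_llt0 ?subr_gt0//.
by rewrite mulNr oppr_lt0 mulr_gt0.
Qed.

Definition angle_of x := xget 0 [set th | 0 <= th <= pi /\ X th = x].

Lemma angle_ofK : {in `[0, pi]%R, cancel X angle_of}.
Proof.
move=> th; rewrite in_itv/= => thpi; rewrite /angle_of.
case: xgetP => [s _ [spi XE]|/(_ th)]; last by case.
have sI : s \in `[0, pi]%R by rewrite in_itv.
have thI : th \in `[0, pi]%R by rewrite in_itv.
case: (ltgtP s th) => // lt_s_th.
  by have := gauss_x_decreasing thI sI lt_s_th; rewrite XE ltxx.
by have := gauss_x_decreasing sI thI lt_s_th; rewrite XE ltxx.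
Qed.

(** The arc of the boundary with normals in the closed upper half-circle, as a
graph over the horizontal axis. *)
Definition upper x := Y (angle_of x).

Let X0pi : X pi = - X 0.
Proof. by have [] := gauss_antipodal 0; rewrite add0r. Qed.

Lemma gauss_x_width : X 0 = h 0.
Proof. by rewrite (gauss_xE cK) cos0 sin0; ring. Qed.

Lemma angle_ofP x : - X 0 <= x <= X 0 -> 0 <= angle_of x <= pi /\ X (angle_of x) = x.
Proof.
move=> xI; rewrite /angle_of; case: xgetP => [th _ //|no].
have X_le : X pi <= X 0 by rewrite X0pi; lra.
have [|th] := segment_continuous_ge_surjective (pi_ge0 R) X_le
    (continuous_subspaceT cX) (t := x).
  by rewrite X0pi/= in_itv.
by rewrite /= in_itv/= => thpi XE; case: (no th).
Qed.

Lemma continuous_upper : {within `[- X 0, X 0], continuous upper}.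
Proof.
have := segment_can_ge_continuous (pi_ge0 R) (continuous_subspaceT cX) angle_ofK.
rewrite X0pi => /subspace_continuousP ca.
apply/subspace_continuousP => x xI; apply: cvg_comp (ca x xI) _; exact: cY.
Qed.

Lemma upper_gauss_x th : 0 <= th <= pi -> upper (X th) = Y th.
Proof. by move=> thpi; rewrite /upper angle_ofK// in_itv. Qed.

Lemma body_le_upper x y : - X 0 <= x <= X 0 -> K (x, y) -> y <= upper x.
Proof.
move=> /angle_ofP[]; set th := angle_of x => thpi XE Kxy.
have [bP sP] := gauss_pointP cK th.
have dotE' q : dot q (dir th) = q.1 * cos th + q.2 * sin th by [].
have := sP _ Kxy; rewrite /upper -/th !dotE' gauss_xy/= XE lerD2l.
have [s0|s0] := eqVneq (sin th) 0.
  (* Where the tangent is vertical it touches [K] at one point only. *)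
  move=> _; have E := gauss_point_unique cK C2K Kxy (th := th).
  rewrite gauss_xy in E; have /E[_ ->] // : supports K (x, y) th.
  by move=> q /sP; rewrite !dotE' gauss_xy/= XE s0 !mulr0 !addr0.
by rewrite ler_pM2r// lt_def s0 sin_ge0_pi.
Qed.

Lemma gauss_x_max q : K q -> - X 0 <= q.1 <= X 0.
Proof.
have le_X p : K p -> p.1 <= X 0.
  move=> Kp; have [_ sP] := gauss_pointP cK 0; have := sP _ Kp.
  by rewrite gauss_xy !dotE/= cos0 sin0 !mulr1 !mulr0 !addr0.
move=> Kq; rewrite le_X// andbT.
by have := le_X _ (symP symK Kq); rewrite /= lerNl.
Qed.

Lemma upper_in x : - X 0 <= x <= X 0 -> K (x, upper x).
Proof.
move=> /angle_ofP[_ XE]; rewrite /upper -[X in K (X, _)]XE -gauss_xy.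
by have [bP _] := gauss_pointP cK (angle_of x); exact: boundary_sub cK _ bP.
Qed.

(** By symmetry, the lower boundary arc is the antipodal image of the graph of
[upper]. *)
Lemma body_sectionE x : - X 0 <= x <= X 0 ->
  xsection K x = `[- upper (- x), upper x].
Proof.
move=> xI; have NxI : - X 0 <= - x <= X 0 by lra.
have lower y : K (x, y) -> - upper (- x) <= y.
  by move=> /(symP symK) Ky; rewrite lerNl; exact: body_le_upper.
apply/seteqP; split=> y.
  move=> /xsectionP Kxy; rewrite /= in_itv/=.
  by rewrite lower// body_le_upper.
rewrite /= in_itv/= => /andP[ly yu]; apply/xsectionP.
have Ku := upper_in xI; have Kl := symP symK (upper_in NxI).
have {Kl} : K (x, - upper (- x)) by move: Kl; rewrite -[- (_, _)]/(- - x, - _) opprK.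
have cvxK : convex_set K by case: cK.
move=> Kl; have := lower _ Ku; rewrite le_eqVlt => /orP[/eqP lu|lu].
  suff -> : y = upper x by [].
  by apply/eqP; rewrite eq_le yu -lu.
set l := - upper (- x) in ly Kl lu *; set u := upper x in yu Ku lu *.
have s0 : 0 <= (y - l) / (u - l) by rewrite divr_ge0//; lra.
have s1 : (y - l) / (u - l) <= 1 by rewrite ler_pdivrMr; lra.
have := convex_combination cvxK Ku Kl s0 s1.
rewrite (_ : _ + _ = (x, y))//.
transitivity ((y - l) / (u - l) * x + (1 - (y - l) / (u - l)) * x,
  (y - l) / (u - l) * u + (1 - (y - l) / (u - l)) * l); first by [].
by congr pair; [ring|field; lra].
Qed.

Lemma body_section_measure x :
  mu (xsection K x) = (((fun z => upper z + upper (- z)) \_ `[- X 0, X 0]) x)%:E.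
Proof.
rewrite patchE; case: ifPn => [|]; rewrite ?inE ?notin_setE/= in_itv/=.
  move=> xI; rewrite body_sectionE// lebesgue_measure_itv/= lte_fin.
  have : - upper (- x) <= upper x.
    have : xsection K x (upper x) by apply/xsectionP/upper_in.
    by rewrite body_sectionE//= in_itv/= => /andP[].
  rewrite le_eqVlt => /orP[/eqP <-|->]; last by rewrite -EFinB opprK.
  by rewrite ltxx addNr.
move=> nxI; rewrite (_ : xsection K x = set0) ?measure0//.
by rewrite -subset0 => y /xsectionP /gauss_x_max.
Qed.

Lemma gauss_x_derive1 : derive1 X = fun th => - sin th * r th.
Proof.
by apply/funext => th; have [_ <-] := gauss_x_derive th; rewrite derive1E.
Qed.

Lemma integral_upper :
  \int[mu]_(x in `[- X 0, X 0]) upper x = \int[mu]_(th in `[0, pi]) (Y th * (sin th * r th)).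
Proof.
have cX' : continuous (derive1 X).
  rewrite gauss_x_derive1 => th; apply: cvgM; last exact: cr.
  by apply: cvgN; exact: continuous_sin.
rewrite /Rintegral -X0pi (integration_by_substitution_decreasing (pi_ge0 R)
  gauss_x_decreasing).
- congr fine; apply: eq_integral => th; rewrite inE/= in_itv/= => thpi.
  transitivity (upper (X th) * - derive1 X th)%:E; first by [].
  by rewrite upper_gauss_x// gauss_x_derive1 mulNr opprK.
- by move=> th _; exact: cX'.
- by apply/cvg_ex; exists (derive1 X 0); apply: cvg_at_right_filter; exact: cX'.
- by apply/cvg_ex; exists (derive1 X pi); apply: cvg_at_left_filter; exact: cX'.
- split; first by move=> th _; have [] := gauss_x_derive th.
    by apply: cvg_at_right_filter; exact: cX.
  by apply: cvg_at_left_filter; exact: cX.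
- by rewrite X0pi; exact: continuous_upper.
Qed.

(** Integrating the lengths of vertical sections and substituting
[x = gauss_x K th] gives the period integral of [Y * sin * r]. Twice this
integrand differs from [h * r] by the derivative of [X * Y]. *)
Lemma area_support : area K = I (fun th => h th * r th) / 2.
Proof.
have X0 : 0 <= X 0 by rewrite gauss_x_width ltW//; exact: body_support_gt0.
have iu : mu.-integrable `[- X 0, X 0] (EFin \o upper).
  apply: continuous_compact_integrable; first exact: segment_compact.
  exact: continuous_upper.
have cuN : {within `[- X 0, X 0], continuous (upper \o -%R)}.
  have /subspace_continuousP cu := continuous_upper.
  apply/subspace_continuousP => x; rewrite /= in_itv/= => xI V.
  have NxI : `[- X 0, X 0] (- x) by rewrite /= in_itv/=; lra.
  move=> nV; have H : nbhs x (-%R @^-1` [set y | `[- X 0, X 0] y -> V (upper y)]).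
    exact: (@oppr_continuous _ R x _ (cu _ NxI _ nV)).
  change (nbhs x [set y | `[- X 0, X 0] y -> V (upper (- y))]).
  apply: filterS H => y /= Vy; rewrite in_itv/= => yI; apply: Vy.
  by rewrite in_itv/=; lra.
have iuN : mu.-integrable `[- X 0, X 0] (EFin \o (upper \o -%R)).
  apply: continuous_compact_integrable; first exact: segment_compact.
  exact: cuN.
have uN : \int[mu]_(x in `[- X 0, X 0]) upper (- x) = \int[mu]_(x in `[- X 0, X 0]) upper x.
  rewrite /Rintegral -[in LHS](integration_by_substitution_oppr (G := upper)) ?opprK//.
    by lra.
  exact: continuous_upper.
have -> : area K = 2 * \int[mu]_(x in `[- X 0, X 0]) upper x.
  rewrite /area /product_measure1; under eq_integral do rewrite /= body_section_measure.
  rewrite -[fine _]/(\int[mu]_x _) -Rintegral_mkcond RintegralD// uN; ring.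
rewrite integral_upper.
pose g th := Y th * (sin th * r th).
have cg : continuous g.
  by apply: continuous_mul => //; apply: continuous_mul => //; exact: continuous_sin.
have [_ _ _ rp _] := smooth_supportP smooth.
have gp : periodic g pi.
  by move=> th; have [_ YN] := gauss_antipodal th; rewrite /g YN sinDpi rp; ring.
have Ig := period_integral_double cg gp.
have chr : continuous (fun th => h th * r th).
  have [ch _ _ _ _] := smooth_supportP smooth; exact: continuous_mul.
have parts : I (fun th => h th * r th - 2 * g th) = 0.
  apply: (@period_integral_derive _ (fun th => X th * Y th)).
  - move=> th; have XYd := is_derive_mul (gauss_x_derive th) (gauss_y_derive th).
    by apply: (is_derive_eq XYd); rewrite /g body_supportE//; ring.
  - by move=> th; apply: cvgB; [exact: chr|apply: cvgMr; exact: cg].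
  - apply: periodic_double => th; have [-> ->] := gauss_antipodal th; ring.
have c2g : continuous (fun th => 2 * g th) by move=> th; apply: cvgMr; exact: cg.
rewrite period_integralB// period_integralZ// Ig in parts.
by rewrite -/g; lra.
Qed.

End area.

(** * Integration against a measure given by a density *)

Section eq_set_function.
Context d (T : measurableType d) (R : realType).
Import HBNNSimple.
Local Open Scope ereal_scope.

(** The integral is defined for arbitrary set functions; this lets one replace
such a function by a measure with the same values on measurable sets. *)
Lemma eq_set_function_integral (m1 m2 : set T -> \bar R) (D : set T)
    (f : T -> \bar R) : (forall A, measurable A -> m1 A = m2 A) ->
  \int[m1]_(x in D) f x = \int[m2]_(x in D) f x.
Proof.
move=> m12.
have eqs (h : {nnsfun T >-> R}) : sintegral m1 h = sintegral m2 h.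
  by apply: eq_fsbigr => r _; rewrite m12.
rewrite /integral; congr (ereal_sup _ - ereal_sup _);
  by apply: eq_imagel => h _; exact: eqs.
Qed.

(** The counterpart of [eq_integral] for set functions without a measure
structure. *)
Lemma eq_set_function_integrand (m : set T -> \bar R) (D : set T)
    (f g : T -> \bar R) : (forall x, D x -> f x = g x) ->
  \int[m]_(x in D) f x = \int[m]_(x in D) g x.
Proof.
move=> fg; rewrite /integral (_ : f \_ D = g \_ D)//.
by apply/funext => x; rewrite !patchE; case: ifPn => // /set_mem; exact: fg.
Qed.

End eq_set_function.

Section density.
Context d (T : measurableType d) (R : realType).
Variable mu : {sigma_finite_measure set T -> \bar R}.
Variable g : T -> R.
Hypotheses (g0 : forall x, 0 <= g x) (ig : mu.-integrable setT (EFin \o g)).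
Local Open Scope ereal_scope.

Definition density_measure (A : set T) := \int[mu]_(x in A) (g x)%:E.

Let density0 : density_measure set0 = 0.
Proof. exact: integral_set0. Qed.

Let density_ge0 A : 0 <= density_measure A.
Proof. by apply: integral_ge0 => x _; rewrite lee_fin. Qed.

Let density_sigma_additive : semi_sigma_additive density_measure.
Proof.
move=> F mF tF mUF; rewrite /density_measure integral_bigcup//; last first.
  exact: integrableS ig.
apply: is_cvg_ereal_nneg_natsum_cond => n _ _.
by apply: integral_ge0 => x _; rewrite lee_fin.
Qed.

HB.instance Definition _ := isMeasure.Build _ _ _
  density_measure density0 density_ge0 density_sigma_additive.

Let density_fin : fin_num_fun density_measure.
Proof.
move=> A mA; apply: integrable_fin_num => //; exact: integrableS ig.
Qed.

HB.instance Definition _ := @Measure_isFinite.Build _ _ _ density_measure density_fin.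

Lemma density_dominates : density_measure `<< mu.
Proof.
apply/null_content_dominatesP => A mA muA0; apply: null_set_integral => //.
exact: (measurable_funS measurableT (@subsetT _ _) (measurable_int mu ig)).
Qed.

Lemma density_integrable (f : T -> R) U (M : R) : measurable U ->
    measurable_fun U f -> (forall x, `|f x| <= M)%R ->
  density_measure.-integrable U (EFin \o f).
Proof.
move=> mU mf fM; apply: measurable_bounded_integrable => //.
  by rewrite ltey_eq density_fin.
exists M; split; first exact: num_real.
by move=> x Mx y _; exact: le_trans (fM y) (ltW Mx).
Qed.

(** The Radon-Nikodym derivative of [density_measure] is [g] almost everywhere. *)
Lemma integral_density (f : T -> R) U (M : R) : measurable U ->
    measurable_fun U f -> (forall x, `|f x| <= M)%R ->
  \int[density_measure]_(x in U) (f x)%:E = \int[mu]_(x in U) (f x * g x)%:E.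
Proof.
move=> mU mf fM; have fi := density_integrable mU mf fM.
rewrite -(Radon_Nikodym_change_of_variables density_dominates)//=.
have mg := measurable_funS measurableT (@subsetT _ U) (measurable_int mu ig).
have iRN : mu.-integrable [set: T]
    (Radon_Nikodym (charge_of_finite_measure density_measure) mu).
  apply: Radon_Nikodym_integrable; exact: density_dominates.
have mEf := measurable_int density_measure fi.
apply: (ae_eq_integral (fun x => (f x)%:E * (g x)%:E)) => //.
- apply: emeasurable_funM => //.
  exact: (measurable_funS measurableT (@subsetT _ _) (measurable_int mu iRN)).
- exact: emeasurable_funM.
- apply: ae_eqe_mul2l; apply: integral_ae_eq => //.
    exact: integrableS iRN.
  move=> E _ mE; rewrite -Radon_Nikodym_integral//.
  exact: density_dominates.
Qed.

End density.

(** * The cone-volume measure in the angular parametrization *)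

Section circle.
Variable R : realType.
Implicit Types (t x : R) (u : R * R).
Local Notation mu := (@lebesgue_measure R).
Local Notation I := (@period_integral R).

Lemma circle_dirP t : circle (dir t).
Proof. exact: dot_dir_norm. Qed.

Lemma measurable_dir : measurable_fun [set: measurableTypeR R] (@dir R).
Proof.
apply/measurable_fun_pairP; split; apply: continuous_measurable_fun.
  exact: continuous_cos.
exact: continuous_sin.
Qed.

(** Equal to [acos] on [[-1, 1]]. The explicit values at and beyond the ends reduce
its measurability to the continuity of [acos] in the open interval. *)
Definition total_acos x : R :=
  if x <= -1 then pi else if 1 <= x then 0 else acos x.

Lemma measurable_total_acos :
  measurable_fun [set: measurableTypeR R] (total_acos : measurableTypeR R -> measurableTypeR R).
Proof.
have m1 : measurable_fun [set: measurableTypeR R] (fun x : R => x <= -1).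
  exact: measurable_fun_ler.
have m2 : measurable_fun [set: measurableTypeR R] (fun x : R => 1 <= x).
  exact: measurable_fun_ler.
apply: measurable_fun_if => //.
apply: measurable_fun_if => //.
- by apply: measurableI => //; rewrite -[X in measurable X]setTI; exact: m1.
- exact: measurable_funTS.
have m3 : measurable_fun (`]-1, 1[ : set (measurableTypeR R))
    (acos : measurableTypeR R -> measurableTypeR R).
  apply: open_continuous_measurable_fun; first exact: interval_open.
  by move=> x; rewrite inE/= in_itv/=; exact: continuous_acos.
apply: measurable_funS m3; first exact: measurable_itv.
move=> x /= [[_ /negbT]]; rewrite -ltNge => xN1 /negbT; rewrite -ltNge => x1.
by rewrite in_itv/= xN1.
Qed.

Lemma total_acosE x : -1 <= x <= 1 -> total_acos x = acos x.
Proof.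
move=> x1; rewrite /total_acos; case: ifPn => [xN1|].
  by have -> : x = -1; [lra|rewrite acosN1].
rewrite -ltNge => xN1; case: ifPn => [x1'|].
  by have -> : x = 1; [lra|rewrite acos1].
by [].
Qed.

Definition total_angle u := if 0 <= u.2 then total_acos u.1 else - total_acos u.1.

Lemma measurable_total_angle :
  measurable_fun [set: R * R] (total_angle : R * R -> measurableTypeR R).
Proof.
have m1 : measurable_fun [set: R * R] (fun u => total_acos u.1).
  by apply: measurableT_comp; [exact: measurable_total_acos|exact: measurable_fst].
apply: measurable_fun_ifT => //; last exact: measurableT_comp.
by apply: measurable_fun_ler => //; exact: measurable_snd.
Qed.

Lemma total_angleE u : circle u -> dir (total_angle u) = u.
Proof.
move=> cu; have -> : total_angle u = angle u.
  by rewrite /total_angle /angle total_acosE// circle_itv.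
by have [] := angleP cu.
Qed.

Lemma measurable_circle : measurable (@circle R).
Proof.
rewrite (_ : circle = (fun u : R * R => u.1 * u.1 + u.2 * u.2) @^-1` [set 1])//.
rewrite -[X in measurable X]setTI.
have m : measurable_fun [set: R * R] (fun u : R * R => u.1 * u.1 + u.2 * u.2).
  by apply: measurable_funD; apply: measurable_funM;
    do ?[exact: measurable_fst|exact: measurable_snd].
by apply: m.
Qed.

(** Functions on the circle are bounded on the line because [[- pi, pi]] already
covers the circle. *)
Lemma continuous_dir_bounded (F : R * R -> R) : continuous (fun t => F (dir t)) ->
  exists M, forall t, `|F (dir t)| <= M.
Proof.
move=> cF; pose G t := `|F (dir t)|.
have cG : continuous G by move=> t; apply: cvg_norm; exact: cF.
have [|c _ cmax] := @EVT_max R G (- pi) pi _ (continuous_subspaceT cG).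
  by have := pi_gt0 R; lra.
exists (G c) => t; have [tpi <-] := angleP (circle_dirP t).
by apply: cmax; rewrite in_itv.
Qed.

Let mD : measurable (`[0, 2 * pi[%classic : set (measurableTypeR R)).
Proof. exact: measurable_itv. Qed.

Let arc := mrestr mu (measurable_itv `[0, 2 * pi[%R).

Let integrable_on (g : R -> R) : continuous g ->
  mu.-integrable setT (EFin \o (g \_ `[0, 2 * pi[)).
Proof.
move=> cg; rewrite -restrict_EFin; apply: (integrable_mkcond _ mD).1.
apply: (integrableS _ _ _ (continuous_integrable 0 (2 * pi) cg)) => //.
exact: subset_itv_co_cc.
Qed.

Lemma integral_arc (f : R -> R) (M : R) A : measurable A ->
    measurable_fun [set: measurableTypeR R] (f : _ -> measurableTypeR R) ->
    (forall x, `|f x| <= M) ->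
  (\int[arc]_(x in A) (f x)%:E =
   \int[mu]_(x in A) ((f \_ `[0, 2 * pi[) x)%:E)%E.
Proof.
move=> mA mf fM; pose one : R -> R := cst 1; pose g : R -> R := one \_ `[0, 2 * pi[.
have g0 x : 0 <= g x by rewrite /g patchE; case: ifPn.
have ig : mu.-integrable setT (EFin \o g) by apply: integrable_on; exact: cst_continuous.
rewrite (@eq_set_function_integral _ (measurableTypeR R) _ _
  (density_measure (T := measurableTypeR R) mu g)).
  rewrite (@integral_density _ (measurableTypeR R) _ _ g g0 ig f A M)//; last exact: measurable_funTS.
  apply: eq_integral => x _; congr EFin; rewrite /g !patchE.
  by case: ifPn; rewrite (mulr1, mulr0).
move=> B mB; rewrite /arc /mrestr /density_measure /g.
pose one_arc := (EFin \o one) \_ `[0, 2 * pi[.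
transitivity (\int[mu]_(x in B) one_arc x)%E; last first.
  by apply: eq_integral => x _; rewrite /one_arc restrict_EFin.
rewrite -integral_mkcondr (integral_cst mu _ 1) ?mul1e//.
exact: measurableI.
Qed.

Section cone_volume.
Variables (L : set (R * R)) (F : R * R -> R).
Let G u := support_function L u / (2 * curvature L u).
Let f t := F (dir t).
Let g t := G (dir t).
Hypotheses (cf : continuous f) (cg : continuous g) (g0 : forall t, 0 <= g t).

Let garc : measurableTypeR R -> R := g \_ `[0, 2 * pi[.

Let garc0 t : 0 <= garc t.
Proof. by rewrite /garc patchE; case: ifPn. Qed.

Let igarc : mu.-integrable setT (EFin \o garc).
Proof. exact: integrable_on. Qed.

(** The cone-volume measure is the image, under [dir], of the measure on the line
with density [g] on one period. *)
Lemma cone_volume_measureE A : measurable A ->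
  cone_volume_measure L A =
  pushforward (density_measure (T := measurableTypeR R) mu garc) (@dir R) A.
Proof.
move=> mA; rewrite /cone_volume_measure.
have mAc : measurable (A `&` circle) by apply: measurableI => //; exact: measurable_circle.
have mgT : measurable_fun [set: measurableTypeR R] (g : _ -> measurableTypeR R).
  exact: continuous_measurable_fun.
have mga : measurable_fun [set: R * R] (fun u => (g (total_angle u))%:E).
  apply/measurable_EFinP; apply: measurableT_comp; first exact: mgT.
  exact: measurable_total_angle.
transitivity (\int[circle_measure]_(u in A `&` circle) (g (total_angle u))%:E)%E.
  by apply: eq_set_function_integrand => u [_ cu]; rewrite /g total_angleE.
rewrite /circle_measure.
rewrite (ge0_integral_pushforward measurable_dir arc mAc); last 2 first.
- exact: measurable_funTS.
- by move=> u _; rewrite lee_fin.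
have [M gM] := continuous_dir_bounded cg.
have mdA : measurable ((@dir R : measurableTypeR R -> _) @^-1` A).
  by rewrite -[X in measurable X]setTI; exact: measurable_dir.
transitivity (\int[arc]_(t in (@dir R) @^-1` A) (g t)%:E)%E.
  rewrite (_ : _ @^-1` (A `&` circle) = (@dir R) @^-1` A); last first.
    by apply/seteqP; split=> t /= => [[]//|At]; split=> //; exact: circle_dirP.
  by apply: eq_integral => t _; rewrite /= /g total_angleE//; exact: circle_dirP.
by rewrite (integral_arc mdA mgT gM).
Qed.

Lemma cone_volume_integral :
  (\int[cone_volume_measure L]_(u in circle) (F u)%:E = (I (fun t => f t * g t))%:E)%E.
Proof.
rewrite (eq_set_function_integral _ _ cone_volume_measureE).
have mfT : measurable_fun [set: measurableTypeR R] (f : _ -> measurableTypeR R).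
  exact: continuous_measurable_fun.
have mfa : measurable_fun [set: R * R] (fun u => (f (total_angle u))%:E).
  apply/measurable_EFinP; apply: measurableT_comp; first exact: mfT.
  exact: measurable_total_angle.
have fE t : f (total_angle (dir t)) = f t.
  by rewrite /f total_angleE//; exact: circle_dirP.
have [M fM] := continuous_dir_bounded cf.
have circleT : (@dir R) @^-1` circle = setT.
  by apply/seteqP; split=> // t _; exact: circle_dirP.
pose nu := density_measure (T := measurableTypeR R) mu garc.
transitivity (\int[pushforward nu (@dir R)]_(u in circle) (f (total_angle u))%:E)%E.
  by apply: eq_set_function_integrand => u cu; rewrite /f total_angleE.
have fnu : nu.-integrable setT (EFin \o f).
  exact: (@density_integrable _ (measurableTypeR R) _ _ garc garc0 igarc f setT M).
rewrite (@integral_pushforward _ _ _ _ _ _ measurable_dir nu circle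
  (fun u => (f (total_angle u))%:E) mfa); last 2 first.
- rewrite circleT (_ : _ \o _ = EFin \o f)//.
  by apply/funext => t /=; rewrite fE.
- exact: measurable_circle.
rewrite circleT.
transitivity (\int[nu]_t (f t)%:E)%E.
  by apply: eq_set_function_integrand => t _ /=; rewrite fE.
rewrite (@integral_density _ (measurableTypeR R) _ _ garc garc0 igarc f setT M)//.
have cfg : continuous (fun t => f t * g t) by exact: continuous_mul.
pose fg : R -> \bar R := fun t => (f t * g t)%:E.
have ifg : mu.-integrable `[0, 2 * pi] fg by exact: continuous_integrable.
pose A : set R := `[0, 2 * pi[.
transitivity (\int[mu]_(t in A) fg t)%E.
  rewrite [RHS]integral_mkcond; apply: eq_integral => t _.
  by rewrite /garc !patchE; case: ifPn => //; rewrite mulr0.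
rewrite /A integral_itv_bndo_bndc.
  by rewrite -(fineK (integrable_fin_num _ ifg)).
apply: measurable_funS (measurable_int mu ifg) => //.
exact: subset_itv_co_cc.
Qed.

End cone_volume.

End circle.

(** * The curvature inequality *)

Unset Implicit Arguments.

Theorem theorem3 (R : realType) (K L : set (R * R))
  (cK : convex_body K) (sK : origin_symmetric K)
  (C2K : has_C2_boundary_of_positive_curvature K)
  (cL : convex_body L) (sL : origin_symmetric L)
  (C2L : has_C2_boundary_of_positive_curvature L) :
  let F : \bar R :=
    (\int[cone_volume_measure L]_(u in circle)
        (ln (curvature K u / curvature L u))%:E
      + (area L / 2 * ln (area K / area L))%:E)%E in
  (0 <= F)%E /\ (F = 0%E <-> dilates K L).
Proof.
move=> F.
have KS := body_smooth_support cK C2K sK; have LS := body_smooth_support cL C2L sL.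
have [_ _ crK hK0 _] := KS; have [_ _ crL hL0 _] := LS.
have [chL _ _ _ _] := smooth_supportP LS.
have ratioE (t : R) : curvature K (dir t) / curvature L (dir t) =
    curvature_radius L t / curvature_radius K t.
  by rewrite /curvature_radius invrK mulrC.
have densityE (t : R) : support_function L (dir t) / (2 * curvature L (dir t)) =
    body_support L t * curvature_radius L t / 2.
  by rewrite /body_support /curvature_radius invfM mulrA mulrAC.
have FE : F = (curvature_entropy (body_support K) (curvature_radius K)
    (body_support L) (curvature_radius L))%:E.
  rewrite /F /curvature_entropy -!area_support// EFinD; congr (_ + _)%E.
  rewrite cone_volume_integral.
  - congr (EFin (period_integral _)); apply/funext => t.
    by rewrite ratioE densityE.
  - rewrite (_ : (fun _ => _) =
      fun t => ln (curvature_radius L t / curvature_radius K t)); last first.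
      by apply/funext => t; rewrite ratioE.
    apply: continuous_ln_comp => [t|].
      by rewrite divr_gt0//; [have [] := hL0 t|have [] := hK0 t].
    by apply: continuous_div => // t; have [] := hK0 t.
  - rewrite (_ : (fun _ => _) =
      fun t => body_support L t * curvature_radius L t * 2^-1); last first.
      by apply/funext => t; rewrite densityE.
    by move=> t; apply: cvgMl; apply: (continuous_mul chL crL).
  - move=> t; rewrite densityE divr_ge0// mulr_ge0// ltW//;
    by have [] := hL0 t.
have cptK := convex_body_compact cK; have K0 := convex_body_nonempty cK.
have cptL := convex_body_compact cL; have L0 := convex_body_nonempty cL.
have [ge0 eq0] := curvature_entropy_inequality KS LS.
rewrite FE; split; first by rewrite lee_fin.
split=> [/eqP|[c c0 KE]].
  rewrite eqe => /eqP /eq0[c c0 hKL]; exists c => //.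
  have cvxK : convex_set K by case: cK.
  have cvxL : convex_set L by case: cL.
  apply/seteqP; split.
    by apply: support_function_sub => // t; rewrite -/(body_support K t) hKL.
  move=> _ [p Lp <-].
  have ci0 : 0 < c^-1 by rewrite invr_gt0.
  have [|q Kq <-] := support_function_sub cptL L0 cptK K0 cvxK ci0 _ Lp.
    by move=> t; rewrite -/(body_support K t) hKL mulKf// gt_eqF.
  by rewrite scalerA divff ?scale1r// gt_eqF.
congr EFin; apply: (curvature_entropy_dilate KS LS c0) => t.
by rewrite /body_support {1}KE support_function_dilate.
Qed.
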